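(* Let $\Gamma$ be a group and let $G$ be a connected graph equipped with an action of $\Gamma$. Then the following are equivalent. (1) There exists a $\Gamma$-equivariant coarse embedding of $G$ into a crossing-bounded median graph (equipped with an action of $\Gamma$). (2) There exists a $\Gamma$-canonical, reduced, proper median decomposition of $G$ over a crossing-bounded median graph. (3) There exists a $\Gamma$-invariant, discrete, crossing-bounded, ECC separation system of $G$ with uniform local width and increasing separations.
   Context: Graphs are simple, undirected, possibly infinite; $d$ is the path metric and group actions on graphs are by automorphisms. Separations. A separation of $G$ is an ordered pair $(A,B)$ of subsets of $V(G)$ with $A\cup B=V(G)$ and no edge joining $A\setminus B$ to $B\setminus A$. It is essential if $A\ne V(G)\neq B$. Its flip is $(B,A)$. Order: $(A,B)\le(C,D)$ iff $A\subseteq C$ and $D\subseteq B$. Two separations are nested if $(A,B)$ is comparable with $(C,D)$ or $(D,C)$; otherwise they cross. A separation system is a set $\Sigma$ of essential separations closed under flips. $\Sigma$ is: $\Gamma$-invariant if $(gA,gB)\in\Sigma$ for all $(A,B)\in\Sigma$, $g\in\Gamma$; discrete if $\{t\in\Sigma: s_1\le t\le s_2\}$ is finite for all $s_1,s_2\in\Sigma$; crossing-bounded if the cardinalities of sets of pairwise-crossing elements of $\Sigma$ are finite and uniformly bounded; ECC if for every infinite strictly descending chain $(A_1,B_1)>(A_2,B_2)>\cdots$ in $\Sigma$, $\bigcap_n(A_n\setminus B_n)=\emptyset$. $\Sigma$ has uniform local width if there is $R\ge0$ such that for all $x\in V(G)$ every chain and every anti-chain in $\Sigma_x=\{(A,B)\in\Sigma: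 x\in A\cap B\}$ has cardinality at most $R$, where an anti-chain means a set of pairwise-crossing elements. $\Sigma$ has increasing separations if for all $r\ge0$ there is $N=N(r)\ge0$, with $N(r)\to\infty$ as $r\to\infty$, such that for all $x,y\in V(G)$ with $d(x,y)\ge r$ there are at least $N$ pairwise distinct $(A,B)\in\Sigma$ with $x\in A\setminus B$ and $y\in B\setminus A$. Median graphs. $I(u,v)$ is the set of vertices on some geodesic from $u$ to $v$. A median graph is a connected graph in which $I(u,v)\cap I(v,w)\cap I(w,u)$ is a single vertex for all $u,v,w$. A subgraph $C$ is convex if every geodesic with endpoints in $C$ is contained in $C$. On oriented edges of a median graph $M$ define $(x,y)\,\Theta\,(u,v)$ iff $d(x,u)+d(y,v)<d(x,v)+d(y,u)$; the classes of this equivalence relation are the oriented $\Theta$-classes, forming the set $\vec{\mathcal H}(M)$. For $\mathfrak h=[(u,v)]$ put $\mathfrak h_+=\{w: d(w,u)<d(w,v)\}$, $\mathfrak h_-=\{w: d(w,u)>d(w,v)\}$. Classes $\mathfrak h,\mathfrak h'$ cross if all four sets $\mathfrak h_\pm\cap\mathfrak h'_\pm$ are non-empty. $M$ is crossing-bounded if the cardinalities of sets of pairwise-crossing $\Theta$-classes are finite and uniformly bounded. Median decompositions. A median decomposition of $G$ (over $M$) is a pair $(M,\beta)$ with $M$ a median graph and $\beta:V(M)\to\mathcal P(V(G))$ such that (M1) $\bigcup_u\beta(u)=V(G)$; (M2) every edge of $G$ has both ends in some $\beta(u)$; (M3) for every $v\in V(G)$ the fibre $\beta^{-1}(v)=\{u: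 v\in\beta(u)\}$ induces a convex subgraph of $M$. It is $\Gamma$-canonical if $\Gamma$ acts on $M$ with $g\cdot\beta(v)=\beta(g\cdot v)$ for all $v\in V(M)$, $g\in\Gamma$. With $A_{\mathfrak h}=\bigcup_{u\in\mathfrak h_+}\beta(u)$, $B_{\mathfrak h}=\bigcup_{u\in\mathfrak h_-}\beta(u)$, it is reduced if every $(A_{\mathfrak h},B_{\mathfrak h})$ is essential and $\mathfrak h\mapsto(A_{\mathfrak h},B_{\mathfrak h})$ is injective on $\vec{\mathcal H}(M)$. It has bounded fibres if there is $R\ge0$ with $\operatorname{diam}(\beta^{-1}(x))\le R$ for all $x\in V(G)$. It is properly supported if for all $r\ge0$ there is $R\ge0$ such that for all $v\in V(M)$, $\operatorname{diam}\{x\in V(G): d(v,\beta^{-1}(x))\le r\}\le R$. It is proper if it has bounded fibres and is properly supported. Coarse embeddings. A map $f:V(X)\to V(Y)$ between graphs is a coarse embedding if there are $K_1\ge1$ and a non-decreasing $\rho:\mathbb N\to\mathbb N$ with $\rho(n)\to\infty$ such that $K_1d(x,y)+K_1\ge d(f(x),f(y))\ge\rho(d(x,y))$ for all $x,y$. It is $\Gamma$-equivariant if $\Gamma$ acts on both graphs and $g\cdot f(x)=f(g\cdot x)$ for all $g\in\Gamma$ and vertices $x$. *)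

(* Defs.v *)
From mathcomp Require Import all_boot.
From mathcomp Require Import boolp classical_sets functions cardinality filter.

Set Implicit Arguments.
Unset Strict Implicit.
Unset Printing Implicit Defensive.

Local Open Scope classical_set_scope.
Local Open Scope card_scope.

(* ** Simple undirected graphs, possibly infinite *)

Record graph := Graph {
  vertex :> eqType;
  adj : rel vertex;
  adj_sym : symmetric adj;
  adj_irr : irreflexive adj }.

(* In every walk [p] from [u] below, the list of all vertices is [u :: p], so
   that [size p] is the number of edges. *)
Definition walk (G : graph) (u v : G) (p : seq G) : bool :=
  path (@adj G) u p && (last u p == v).

Definition connected_graph (G : graph) : Prop :=
  forall u v : G, exists p, walk u v p.

Definition walk_length (G : graph) (u v : G) : pred nat :=
  fun n => `[< exists2 p, walk u v p & size p = n >].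

(* The path metric. The value 0 for vertices that are not joined by a walk is
   never used: all graphs whose metric is considered are connected. *)
Definition gdist (G : graph) (u v : G) : nat :=
  if pselect (exists n, walk_length u v n) is left h then ex_minn h else 0.

Definition geodesic (G : graph) (u v : G) (p : seq G) : bool :=
  walk u v p && (size p == gdist u v).

Definition diam_le (G : graph) (S : set G) (R : nat) : Prop :=
  forall x y, S x -> S y -> gdist x y <= R.

(* ** Group actions by graph automorphisms *)

Record graph_action (Gamma : groupType) (G : graph) := GraphAction {
  act :> Gamma -> G -> G;
  act1 : forall x, act 1%g x = x;
  actM : forall g h x, act (g * h)%g x = act g (act h x);
  act_adj : forall g x y, adj (act g x) (act g y) = adj x y }.

(* ** Bounded families of pairwise crossing elements *)

Definition pairwise_rel (T : Type) (r : T -> T -> Prop) (X : set T) : Prop :=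
  forall s t, X s -> X t -> s <> t -> r s t.

Definition crossing_bounded (T : Type) (cross : T -> T -> Prop) (S : set T) :
    Prop :=
  exists N : nat, forall X : set T,
    X `<=` S -> pairwise_rel cross X -> X #<= `I_N.

(* ** Separations *)

Section Separations.
Variable G : graph.
Implicit Types (s t : set G * set G) (Sigma : set (set G * set G)).

Definition is_separation s : Prop :=
  s.1 `|` s.2 = setT /\
  forall x y, (s.1 `\` s.2) x -> (s.2 `\` s.1) y -> ~~ adj x y.

Definition essential s : Prop := s.1 <> setT /\ s.2 <> setT.

Definition flip s : set G * set G := (s.2, s.1).

Definition sep_le s t : Prop := s.1 `<=` t.1 /\ t.2 `<=` s.2.

Definition sep_lt s t : Prop := sep_le s t /\ s <> t.

Definition sep_comparable s t : Prop := sep_le s t \/ sep_le t s.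

Definition nested s t : Prop :=
  sep_comparable s t \/ sep_comparable s (flip t).

Definition sep_cross s t : Prop := ~ nested s t.

Definition separation_system Sigma : Prop :=
  forall s, Sigma s -> [/\ is_separation s, essential s & Sigma (flip s)].

Definition sep_invariant (Gamma : groupType) (a : graph_action Gamma G) Sigma :
    Prop :=
  forall g s, Sigma s -> Sigma (a g @` s.1, a g @` s.2).

Definition sep_discrete Sigma : Prop :=
  forall s1 s2, Sigma s1 -> Sigma s2 ->
    finite_set [set t | [/\ Sigma t, sep_le s1 t & sep_le t s2]].

Definition sep_crossing_bounded Sigma : Prop := crossing_bounded sep_cross Sigma.

Definition ECC Sigma : Prop :=
  forall s : nat -> set G * set G,
    (forall n, Sigma (s n)) -> (forall n, sep_lt (s n.+1) (s n)) ->
    \bigcap_n ((s n).1 `\` (s n).2) = set0.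

Definition local_seps Sigma (x : G) : set (set G * set G) :=
  [set s | Sigma s /\ (s.1 `&` s.2) x].

Definition uniform_local_width Sigma : Prop :=
  exists R : nat, forall (x : G) (X : set (set G * set G)),
    X `<=` local_seps Sigma x ->
    pairwise_rel sep_comparable X \/ pairwise_rel sep_cross X ->
    X #<= `I_R.

Definition increasing_separations Sigma : Prop :=
  exists2 N : nat -> nat, N @ \oo --> \oo &
    forall (r : nat) (x y : G), r <= gdist x y ->
      `I_(N r) #<= [set s | [/\ Sigma s, (s.1 `\` s.2) x & (s.2 `\` s.1) y]].

End Separations.

(* ** Median graphs *)

Section MedianGraphs.
Variable M : graph.
Implicit Types (u v w : M) (e f : M * M) (h k : set (M * M)).

Definition geod_interval u v : set M :=
  [set w | exists2 p, geodesic u v p & w \in u :: p].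

Definition median_graph : Prop :=
  connected_graph M /\
  forall u v w, exists x,
    geod_interval u v `&` geod_interval v w `&` geod_interval w u = [set x].

Definition convex (C : set M) : Prop :=
  forall u v p, C u -> C v -> geodesic u v p -> [set` u :: p] `<=` C.

Definition oriented_edges : set (M * M) := [set e | adj e.1 e.2].

Definition theta e f : bool :=
  gdist e.1 f.1 + gdist e.2 f.2 < gdist e.1 f.2 + gdist e.2 f.1.

Definition theta_class e : set (M * M) :=
  [set f | oriented_edges f /\ theta e f].

Definition theta_classes : set (set (M * M)) :=
  [set theta_class e | e in oriented_edges].

(* The two sides of a class [h] in a median graph do not depend on the oriented
   edge [e] chosen to represent [h]. *)
Definition plus_side h : set M :=
  [set w | exists2 e, h e & gdist w e.1 < gdist w e.2].

Definition minus_side h : set M :=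
  [set w | exists2 e, h e & gdist w e.1 > gdist w e.2].

Definition theta_cross h k : Prop :=
  [/\ plus_side h `&` plus_side k !=set0,
      plus_side h `&` minus_side k !=set0,
      minus_side h `&` plus_side k !=set0 &
      minus_side h `&` minus_side k !=set0].

Definition graph_crossing_bounded : Prop :=
  crossing_bounded theta_cross theta_classes.

End MedianGraphs.

(* ** Median decompositions *)

Section MedianDecompositions.
Variables (G M : graph) (beta : M -> set G).

Definition fibre (x : G) : set M := [set u | beta u x].

Definition median_decomposition : Prop :=
  [/\ median_graph M,
      \bigcup_u beta u = setT,
      forall x y : G, adj x y -> exists u, beta u x /\ beta u y &
      forall x : G, convex (fibre x)].

Definition canonical_decomposition (Gamma : groupType)
    (aG : graph_action Gamma G) (aM : graph_action Gamma M) : Prop :=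
  forall g u, aG g @` beta u = beta (aM g u).

Definition theta_separation (h : set (M * M)) : set G * set G :=
  (\bigcup_(u in plus_side h) beta u, \bigcup_(u in minus_side h) beta u).

Definition reduced_decomposition : Prop :=
  (forall h, theta_classes h -> essential (theta_separation h)) /\
  set_inj (@theta_classes M) theta_separation.

Definition bounded_fibres : Prop :=
  exists R : nat, forall x : G, diam_le (fibre x) R.

(* The distance from [v] to the fibre of [x], a non-empty set of vertices, is
   at most [r] exactly when some vertex of the fibre is at distance at most [r]
   from [v]. *)
Definition properly_supported : Prop :=
  forall r : nat, exists R : nat, forall v : M,
    diam_le [set x | exists2 u, fibre x u & gdist v u <= r] R.

Definition proper_decomposition : Prop := bounded_fibres /\ properly_supported.

End MedianDecompositions.

(* ** Coarse embeddings *)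

Definition coarse_embedding (X Y : graph) (f : X -> Y) : Prop :=
  exists (K : nat) (rho : nat -> nat),
    [/\ 1 <= K, {homo rho : m n / m <= n}, rho @ \oo --> \oo &
        forall x y : X,
          rho (gdist x y) <= gdist (f x) (f y) <= K * gdist x y + K].

Definition equivariant (Gamma : groupType) (X Y : graph)
    (aX : graph_action Gamma X) (aY : graph_action Gamma Y) (f : X -> Y) :
    Prop :=
  forall g x, aY g (f x) = f (aX g x).

(* Main.v *)
Require Import Defs.
From mathcomp Require Import all_boot.
From mathcomp Require Import boolp classical_sets functions cardinality filter.
From mathcomp Require Import zify.

(* The halfspaces of a median graph correspond to its oriented Theta-classes,
   and the distance between two vertices is the number of halfspaces separating
   them. Let F(x), for x in G, be bounded sets of vertices of a crossing-bounded
   median graph M, with F(x) meeting F(y) for adjacent x, y. Each halfspace H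
   of M yields the separation (A, B) of G, where x is in A (resp. B) when F(x)
   meets H (resp. its complement). Among the halfspaces cutting a bounded set,
   chains are bounded by the diameter and antichains by the crossing number, so
   by Mirsky's theorem boundedly many of them give the same separation and
   boundedly many separating halfspaces are lost. Taking for F(x) a ball around
   f(x), or the fibre of x, gives (1) => (3) and (2) => (3).

   For (3) => (2), M is the graph of those orientations of Sigma that differ
   finitely from some orientation all of whose members (A, B) contain a given
   vertex in A. For (3) => (1), the stabiliser of x need not fix a vertex of the
   fibre of x in M, but it preserves the cube of M at its centre, found by
   comparing the lengths of the chains below a separation and below its flip;
   the barycentre of the cube becomes a vertex of the cubical subdivision of M,
   dual to the lexicographic product of Sigma with a two-element chain. *)

Set Implicit Arguments.
Unset Strict Implicit.
Unset Printing Implicit Defensive.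

Local Open Scope classical_set_scope.
Local Open Scope card_scope.

(** * Cardinality bounds *)

(** Duplicate-free lists give a bound that can be used before [X] is known to be finite;
    [card_le_size_bounded] translates it to cardinals. *)
Definition size_bounded (T : eqType) (X : set T) (n : nat) : Prop :=
  forall s : seq T, uniq s -> [set` s] `<=` X -> size s <= n.

Lemma size_boundedW (T : eqType) (X Y : set T) m n :
  X `<=` Y -> m <= n -> size_bounded Y m -> size_bounded X n.
Proof.
by move=> XY mn Yb s us sX; rewrite (leq_trans (Yb s us _) mn)// => x /sX /XY.
Qed.

Lemma size_bounded_enum (T : eqType) (X : set T) n :
  size_bounded X n -> exists2 s : seq T, uniq s & X = [set` s].
Proof.
elim: n X => [|n IHn] X Xb.
  exists [::] => //; rewrite predeqE => x; split => // Xx.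
  have // : size [:: x] <= 0.
  by apply: Xb => // y /=; rewrite inE => /eqP->.
have [[x Xx]|X0] := pselect (exists x, X x); last first.
  exists [::] => //; rewrite predeqE => x; split => // Xx.
  by case: X0; exists x.
case: (IHn (X `\ x)) => [s us sX|s us sE].
  have := Xb (x :: s); rewrite /= us andbT; apply.
    by apply/negP => /sX[_]; apply.
  by move=> y /=; rewrite inE => /predU1P[->//|/sX[]].
have ys y : (y \in s) <-> X y /\ y <> x.
  by have -> : (y \in s : Prop) = [set` s] y by []; rewrite -sE.
exists (x :: s).
  by rewrite /= us andbT; apply/negP => /ys[].
rewrite predeqE => y /=; rewrite inE; split.
  by move=> Xy; case: eqVneq => //= /eqP yx; apply/ys.
by move=> /predU1P[->//|/ys[]].
Qed.

Lemma size_bounded_seq (T : eqType) (s : seq T) :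
  size_bounded [set` s] (size s).
Proof. by move=> s' us' ss'; apply: uniq_leq_size. Qed.

Lemma card_set_seq (T : eqType) (s : seq T) :
  uniq s -> [set` s] #= `I_(size s).
Proof.
move=> us.
have <- : (index^~ s) @` [set` s] = `I_(size s).
  rewrite predeqE => i; split => [[x /= xs <-]|/= i_s].
    by rewrite index_mem.
  have x0 : T by case: s i_s {us}.
  by exists (nth x0 s i); rewrite /= ?mem_nth// index_uniq.
rewrite card_eq_sym; apply: inj_card_eq => x y; rewrite !inE /= => xs ys.
by move=> /(congr1 (nth x s)); rewrite !nth_index.
Qed.

Lemma card_le_size_bounded (T : eqType) (X : set T) n :
  X #<= `I_n <-> size_bounded X n.
Proof.
split=> [Xn s us sX|Xb].
  rewrite -card_le_II -(card_le_eql (card_set_seq us)).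
  exact: card_le_trans (subset_card_le sX) Xn.
have [s us sE] := size_bounded_enum Xb.
rewrite sE (card_le_eql (card_set_seq us)) card_le_II.
by apply: Xb => //; rewrite sE.
Qed.

Lemma card_ge_seq (T : eqType) (X : set T) n :
  `I_n #<= X <-> exists s : seq T, [/\ uniq s, [set` s] `<=` X & n <= size s].
Proof.
split=> [nX|[s [us sX ns]]]; last first.
  apply: card_le_trans (subset_card_le sX).
  by rewrite (card_le_eqr (card_set_seq us)) card_le_II.
apply: contrapT => Xs; case: n nX Xs => [|n] nX Xs.
  by apply: Xs; exists [::].
have Xb : X #<= `I_n.
  apply/card_le_size_bounded => s us sX; rewrite -ltnS ltnNge.
  by apply/negP => ns; apply: Xs; exists s.
by have := card_le_trans nX Xb; rewrite card_le_II ltnn.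
Qed.

Lemma finite_size_bounded (T : eqType) (X : set T) :
  finite_set X <-> exists n, size_bounded X n.
Proof.
rewrite finite_set_leP; split=> -[n] Xn; exists n.
  exact/card_le_size_bounded.
exact/card_le_size_bounded.
Qed.

Lemma size_boundedU (T : eqType) (X Y : set T) m n :
  size_bounded X m -> size_bounded Y n -> size_bounded (X `|` Y) (m + n).
Proof.
move=> Xb Yb s us sXY; rewrite -(count_predC (fun x => `[< X x >]) s).
rewrite -!size_filter leq_add//.
  apply: Xb; first exact: filter_uniq.
  by move=> x /=; rewrite mem_filter => /andP[/asboolP].
apply: Yb; first exact: filter_uniq.
move=> x /=; rewrite mem_filter => /andP[/asboolPn nXx /sXY].
by case.
Qed.

(** Induction on [n]: remove one [u] from [Y] and everything related to it from [X]. A relation in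
    place of a map spares choosing a halfspace for each separation. *)
Lemma size_bounded_fibres (T U : eqType) (r : T -> U -> Prop)
    (X : set T) (Y : set U) m n :
    (forall x, X x -> exists2 u, Y u & r x u) ->
    (forall u, Y u -> size_bounded [set x | X x /\ r x u] m) ->
  size_bounded Y n -> size_bounded X (n * m).
Proof.
elim: n X Y => [|n IHn] X Y XY fib Yb s us sX.
  case: s us sX => // x s us sX; have [|u Yu _] := XY x.
    by apply: sX; rewrite /= mem_head.
  have // : size [:: u] <= 0.
  by apply: Yb => // y /=; rewrite inE => /eqP->.
case: s us sX => // x s; move sE : (x :: s) => s' us sX.
have xs : x \in s' by rewrite -sE mem_head.
have [u Yu rxu] := XY x (sX x xs).
rewrite -(count_predC (fun y => `[< r y u >]) s') -!size_filter mulSn leq_add//.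
  apply: (fib u Yu); first exact: filter_uniq.
  move=> y /=; rewrite mem_filter => /andP[/asboolP ryu /sX Xy].
  by split.
apply: (IHn [set y | X y /\ ~ r y u] (Y `\ u)).
- move=> y [Xy nryu]; have [v Yv ryv] := XY y Xy.
  by exists v => //; split=> // vu; apply: nryu; rewrite -vu.
- by move=> v [Yv _]; apply: size_boundedW (fib v Yv) => // y [[]].
- move=> t ut tY; rewrite -ltnS; apply: (Yb (u :: t)).
    by rewrite /= ut andbT; apply/negP => /tY[_]; apply.
  by move=> v /=; rewrite inE => /predU1P[->|/tY[]].
- exact: filter_uniq.
- move=> y /=; rewrite mem_filter => /andP[/asboolPn nr /sX Xy].
  by split.
Qed.

Lemma size_bounded_inj (T U : eqType) (r : T -> U -> Prop)
    (X : set T) (Y : set U) n :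
    (forall x, X x -> exists2 u, Y u & r x u) ->
    (forall x y u, X x -> X y -> r x u -> r y u -> x = y) ->
  size_bounded Y n -> size_bounded X n.
Proof.
move=> XY rinj Yb; rewrite -(muln1 n).
apply: size_bounded_fibres XY _ Yb => u Yu s us sX.
case: s us sX => // x [|y s] //= /andP[xys _] sX.
have [Xx rx] : X x /\ r x u by apply: sX; rewrite /= mem_head.
have [Xy ry] : X y /\ r y u by apply: sX; rewrite /= !inE eqxx orbT.
by rewrite (rinj x y u)// mem_head in xys.
Qed.

(** Injectivity is asked only of crossing pairs. This allows correspondences that identify nested
    elements, such as the two copies of an element in [double]. *)
Lemma crossing_bounded_transfer (T U : eqType) (r : T -> U -> Prop)
    (cT : T -> T -> Prop) (cU : U -> U -> Prop) (X : set T) (Y : set U) :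
    (forall x, X x -> exists2 u, Y u & r x u) ->
    (forall x y u, X x -> X y -> r x u -> r y u -> cT x y -> x = y) ->
    (forall x y u v, r x u -> r y v -> cT x y -> cU u v) ->
  crossing_bounded cU Y -> crossing_bounded cT X.
Proof.
move=> XY rinj rc [N YN]; exists N => Z ZX Zc.
have [[z Zz]|Z0] := pselect (exists z, Z z); last first.
  apply/card_le_size_bounded => -[//|x s _ sZ].
  by case: Z0; exists x; apply: sZ; rewrite /= mem_head.
(* The choice function is total; [u0] is its value outside [X]. *)
have [u0 _ _] := XY z (ZX z Zz).
have /choice[f fP] : forall x, exists u, X x -> Y u /\ r x u.
  move=> x; have [/XY[u Yu ru]|nXx] := pselect (X x); first by exists u.
  by exists u0.
apply/card_le_size_bounded.
apply: (@size_bounded_inj _ _ (fun x u => f x = u) _ (f @` Z)).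
- by move=> x Zx; exists (f x) => //; exists x.
- move=> x y u Zx Zy fx fy; apply: contrapT => xy; apply: (xy).
  have [_ rx] := fP x (ZX x Zx); have [_ ry] := fP y (ZX y Zy).
  apply: (rinj x y u (ZX x Zx) (ZX y Zy)); last exact: Zc.
    by rewrite -fx.
  by rewrite -fy.
- apply/card_le_size_bounded; apply: YN => [_ [x Zx <-]|].
    by case: (fP x (ZX x Zx)).
  move=> _ _ [x Zx <-] [y Zy <-] fxy.
  have [_ rx] := fP x (ZX x Zx); have [_ ry] := fP y (ZX y Zy).
  by apply: rc rx ry _; apply: Zc => // xy; apply: fxy; rewrite xy.
Qed.

(* Mirsky's theorem, by peeling off the antichain of minimal elements. *)
Lemma size_bounded_chain_antichain (T : eqType) (lt : rel T) (X : set T) a b :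
    transitive lt -> irreflexive lt ->
    (forall c, sorted lt c -> [set` c] `<=` X -> size c <= a) ->
    (forall c, uniq c -> [set` c] `<=` X -> {in c &, forall x y, ~~ lt x y} ->
      size c <= b) ->
  size_bounded X (a * b).
Proof.
move=> lt_tr lt_irr Xa Xb s us sX.
have {Xa}: forall c, sorted lt c -> {subset c <= s} -> size c <= a.
  by move=> c cs cX; apply: Xa => // x /cX /sX.
elim: a s us sX => [|a IHa] s us sX sa.
  case: s us sX sa => // x s us sX sa.
  by apply: (sa [:: x]) => // y; rewrite inE => /eqP->; rewrite mem_head.
pose p x := ~~ has (lt^~ x) s.
rewrite -(count_predC p s) -!size_filter mulSn leq_add//.
  apply: Xb; first exact: filter_uniq.
    by move=> x /=; rewrite mem_filter => /andP[_ /sX].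
  move=> x y; rewrite !mem_filter => /andP[_ xs] /andP[/hasPn py _].
  exact: py.
apply: IHa; first exact: filter_uniq.
  by move=> x /=; rewrite mem_filter => /andP[_ /sX].
move=> [//|x c] cs cX; rewrite -ltnS.
have := cX x (mem_head _ _); rewrite mem_filter /= negbK => /andP[/hasP[y ys yx] xs].
apply: (sa (y :: x :: c)); first by rewrite /= yx.
move=> z; rewrite inE => /predU1P[->//|/cX]; by rewrite mem_filter => /andP[].
Qed.

(** * Path metric and halfspaces of median graphs *)

Section Metric.
Variables (G : graph) (G_conn : connected_graph G).
Implicit Types u v w : G.

Lemma gdist_le u v p : walk u v p -> gdist u v <= size p.
Proof.
move=> wp; rewrite /gdist; case: pselect => // h.
by case: ex_minnP => m _; apply; apply/asboolP; exists p.
Qed.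

Lemma geodesic_exists u v : exists p, geodesic u v p.
Proof.
rewrite /geodesic /gdist; case: pselect => [h|[]]; last first.
  by have [p wp] := G_conn u v; exists (size p); apply/asboolP; exists p.
case: ex_minnP => m /asboolP[p wp <-] _; exists p.
by rewrite wp eqxx.
Qed.

Lemma walk_cat u v w p q : walk u v p -> walk v w q -> walk u w (p ++ q).
Proof.
rewrite /walk => /andP[pp /eqP lp] /andP[pq lq].
by rewrite cat_path last_cat lp pp pq lq.
Qed.

Lemma walk_rev u v p : walk u v p -> exists2 q, walk v u q & size q = size p.
Proof.
elim: p u => [|x p IHp] u; rewrite /walk /=.
  by move=> /eqP->; exists [::] => //=.
move=> /andP[/andP[ux px] lp]; have [|q wq sq] := IHp x.
  by rewrite /walk px lp.
exists (q ++ [:: u]); last by rewrite size_cat addn1 sq.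
by apply: walk_cat wq _; rewrite /walk /= adj_sym ux eqxx.
Qed.

Lemma gdistC u v : gdist u v = gdist v u.
Proof.
suff le (x y : G) : gdist x y <= gdist y x by apply/eqP; rewrite eqn_leq !le.
have [p /andP[/walk_rev[q wq sq] /eqP <-]] := geodesic_exists y x.
by rewrite -sq gdist_le.
Qed.

Lemma gdist_triangle v u w : gdist u w <= gdist u v + gdist v w.
Proof.
have [p /andP[wp /eqP <-]] := geodesic_exists u v.
have [q /andP[wq /eqP <-]] := geodesic_exists v w.
by rewrite -size_cat; apply/gdist_le/walk_cat/wq.
Qed.

Lemma gdistxx u : gdist u u = 0.
Proof. by apply/eqP; rewrite -leqn0 (@gdist_le _ _ [::])// /walk /=. Qed.

Lemma gdist_eq0 u v : gdist u v = 0 -> u = v.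
Proof.
have [p /andP[+ /eqP <-]] := geodesic_exists u v.
by case: p => // /andP[_ /eqP].
Qed.

Lemma gdist_adj u v : adj u v -> gdist u v = 1.
Proof.
move=> uv; have : gdist u v <= 1.
  by rewrite (@gdist_le _ _ [:: v])// /walk /= uv eqxx.
case: (gdist u v) (@gdist_eq0 u v) => [/(_ erefl) e|[]//].
by rewrite e adj_irr in uv.
Qed.

Lemma geodesic_split u v p w : geodesic u v p -> w \in u :: p ->
  gdist u w + gdist w v = gdist u v.
Proof.
move=> /andP[/andP[pp /eqP lp] /eqP sp]; rewrite inE => /predU1P[->|wp].
  by rewrite gdistxx.
apply/eqP; rewrite eqn_leq gdist_triangle andbT -sp.
case/splitPr: wp pp lp sp => p1 p2; rewrite cat_path last_cat /=.
move=> /and3P[pp1 lw pp2] lp _; rewrite size_cat /= addnS -addSn leq_add//.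
  rewrite -(size_rcons p1 w) gdist_le// /walk rcons_path pp1 lw last_rcons.
  exact: eqxx.
by rewrite gdist_le// /walk pp2 lp eqxx.
Qed.

Lemma geod_intervalE u v w :
  geod_interval u v w <-> gdist u w + gdist w v = gdist u v.
Proof.
split=> [[p gp wp]|uwv]; first exact: geodesic_split gp wp.
have [p /andP[wp /eqP sp]] := geodesic_exists u w.
have [q /andP[wq /eqP sq]] := geodesic_exists w v.
exists (p ++ q).
  by rewrite /geodesic (walk_cat wp wq) size_cat sp sq uwv eqxx.
move: wp => /andP[_ /eqP <-].
by rewrite -cat_cons mem_cat mem_last.
Qed.

Lemma geodesic_step u v : u <> v ->
  exists2 w, adj u w & gdist u v = (gdist w v).+1.
Proof.
have [p /andP[+ /eqP sp]] := geodesic_exists u v.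
case: p sp => [|w p] sp; first by rewrite /walk /= => /eqP.
rewrite /walk /= => /andP[/andP[uw pp] lp] _; exists w => //.
apply/eqP; rewrite eqn_leq -{2}sp /= ltnS gdist_le ?andbT//.
  by rewrite -add1n -(gdist_adj uw) gdist_triangle.
by rewrite /walk pp lp.
Qed.

End Metric.

Lemma gdist_act (Gamma : groupType) (G : graph) (a : graph_action Gamma G) :
  connected_graph G -> forall g u v, gdist (a g u) (a g v) = gdist u v.
Proof.
move=> G_conn.
suff le g u v : gdist (a g u) (a g v) <= gdist u v.
  move=> g u v; apply/eqP; rewrite eqn_leq le /=.
  have := le g^-1%g (a g u) (a g v).
  by rewrite -!actM mulVg !act1.
have [p /andP[/andP[pp /eqP lp] /eqP <-]] := geodesic_exists G_conn u v.
rewrite -(size_map (a g)) gdist_le// /walk last_map lp eqxx andbT.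
by rewrite path_map (eq_path (e' := @adj G))// => x y /=; rewrite act_adj.
Qed.

(** * Halfspaces of a median graph and their Theta-classes *)

Definition side (M : graph) (a b : M) : set M :=
  [set w | gdist w a < gdist w b].

Definition halfspaces (M : graph) : set (set M) :=
  [set H | exists a b : M, adj a b /\ H = side a b].

Definition set_cross (T : Type) (H K : set T) : Prop :=
  [/\ H `&` K !=set0, H `&` ~` K !=set0, ~` H `&` K !=set0 &
      ~` H `&` ~` K !=set0].

Section Median.
Variables (M : graph) (M_med : median_graph M).
Implicit Types (a b u v w : M) (H K : set M).

Let M_conn : connected_graph M. Proof. by case: M_med. Qed.
Let dC := gdistC M_conn.
Let dT := gdist_triangle M_conn.

Lemma median_exists u v w : exists x,
  [/\ gdist u x + gdist x v = gdist u v, gdist v x + gdist x w = gdist v w &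
      gdist w x + gdist x u = gdist w u].
Proof.
case: M_med => _ /(_ u v w)[x /seteqP[_ /(_ x erefl)[[ux vx] wx]]].
by exists x; split; apply/geod_intervalE.
Qed.

Lemma median_unique u v w x y :
  gdist u x + gdist x v = gdist u v -> gdist v x + gdist x w = gdist v w ->
  gdist w x + gdist x u = gdist w u ->
  gdist u y + gdist y v = gdist u v -> gdist v y + gdist y w = gdist v w ->
  gdist w y + gdist y u = gdist w u -> x = y.
Proof.
move=> ux vx wx uy vy wy.
case: M_med => _ /(_ u v w)[z /seteqP[zP _]].
have -> : x = z by apply: zP; split; first split; apply/geod_intervalE.
by apply/esym/zP; split; first split; apply/geod_intervalE.
Qed.

(** The median of [a], [b] and [w] lies on the edge, so it is one of its two ends, and the equations
    of the intervals give the difference of one. *)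
Lemma median_bipartite a b w : adj a b ->
  gdist w b = (gdist w a).+1 \/ gdist w a = (gdist w b).+1.
Proof.
move=> ab; have [x [axb bxw wxa]] := median_exists a b w.
have ab1 := gdist_adj M_conn ab.
have := dC b w; have := dC a w; have := dC a b; have := dC b x.
have := dC a x; have := dC x w.
have := @gdist_eq0 _ M_conn a x; have := @gdist_eq0 _ M_conn x b.
case: (gdist a x) axb => [|[|n]] => [xb _|xb|]; last by lia.
  by move=> /(_ erefl) e; move: bxw wxa; rewrite -e gdistxx; lia.
have x0 : gdist x b = 0 by lia.
by move=> /(_ x0) e _; move: bxw wxa; rewrite e gdistxx -?e; lia.
Qed.

Lemma sideC a b : adj a b -> ~` side a b = side b a.
Proof.
move=> ab; rewrite predeqE => w; rewrite /side /=.
by case: (median_bipartite w ab) => ->; split; lia.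
Qed.

Lemma side_left a b : adj a b -> side a b a.
Proof. by move=> ab; rewrite /side /= gdistxx (gdist_adj M_conn ab). Qed.

(* If [w] were on the [b]-side, pushing [w] towards [u], [v] and [b] by medians
   would produce a second median of [u], [v] and [b]. *)
Lemma side_convex a b u v w : adj a b -> side a b u -> side a b v ->
  gdist u w + gdist w v = gdist u v -> side a b w.
Proof.
move=> ab; rewrite /side /= => ua va uwv.
rewrite ltnNge; apply/negP => wb.
have ab1 := gdist_adj M_conn ab.
have ub : gdist u b = (gdist u a).+1 by case: (median_bipartite u ab); lia.
have vb : gdist v b = (gdist v a).+1 by case: (median_bipartite v ab); lia.
have wa : gdist w a = (gdist w b).+1 by case: (median_bipartite w ab); lia.
have [m [um vm am]] := median_exists u v a.
have [p [up wp bp]] := median_exists u w b.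
have [q [pq vq bq]] := median_exists p v b.
have mb : gdist m b = (gdist m a).+1.
  have := dT m u b; have := dT a m b; have := dC a u; have := dC a m.
  by have := dC u m; lia.
have qa : gdist q a = (gdist q b).+1.
  have := dT p w a; have := dT q p a; have := dT b p a; have := dT b q a.
  have := dC b p; have := dC b q; have := dC p q; have := dC p w.
  by have := dC b a; lia.
(* [m] lies on the side of [a] and [q] on that of [b], yet both turn out to be medians of [u], [v]
   and [b]. *)
suff mq : m = q by rewrite mq in mb; lia.
have uqv : gdist u q + gdist q v = gdist u v.
  by have := dT q u v; have := dT p u q; have := dT w p v; lia.
have bqu : gdist b q + gdist q u = gdist b u.
  have := dT q b u; have := dT p u q; have := dC q u; have := dC p u.
  by have := dC p q; lia.
apply: (@median_unique u v b) => //.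
  by have := dC v m; have := dC m b; lia.
have := dT m b u; have := dC b m; have := dC u m; have := dC b u.
by have := dC a m; have := dC a u; lia.
Qed.

(** If some [w] in [side a b] were nearer to [d] than to [c], then [d] would lie between [w] and
    [c], and convexity would put [d] in [side a b]. *)
Lemma side_eq a b c d : adj a b -> adj c d -> side a b c -> side b a d ->
  side a b = side c d.
Proof.
suff le a' b' c' d' : adj a' b' -> adj c' d' -> side a' b' c' ->
    side b' a' d' -> side a' b' `<=` side c' d'.
  move=> ab cd abc bad; rewrite eqEsubset; split; first exact: le.
  move=> w cdw; apply: contrapT => nabw.
  have baw : side b a w by rewrite -sideC.
  have : (~` side c d) w by rewrite sideC//; apply: le baw; rewrite 1?adj_sym.
  exact.
move=> ab cd abc bad w abw; apply: contrapT.
have : (~` side c' d') w -> False.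
  rewrite sideC// /side /= => dcw.
  have d_ab : side a' b' d'.
    apply: (@side_convex a' b' w c') => //.
    have := gdist_adj M_conn cd; have := dC c' d'.
    by case: (median_bipartite w cd); lia.
  by move: bad; rewrite -sideC.
by [].
Qed.

(** The distances from a vertex to the ends of an edge differ by exactly one, so the strict
    inequality forces [a] to the side of [c] and [b] to the side of [d]; [side_eq] concludes. *)
Lemma theta_sideE a b c d : adj a b -> adj c d ->
  theta (a, b) (c, d) <-> side a b = side c d.
Proof.
move=> ab cd; rewrite /theta /=; split=> [th|abcd].
  suff [ca db] : side c d a /\ side d c b by apply/esym/side_eq.
  rewrite /side /=.
  by case: (median_bipartite a cd); case: (median_bipartite b cd); lia.
have := side_left ab; rewrite abcd /side /= => ca.
have : side b a b by apply: side_left; rewrite adj_sym.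
by rewrite -sideC// abcd sideC// /side /=; lia.
Qed.

Lemma plus_side_class a b : adj a b ->
  plus_side (theta_class (a, b)) = side a b.
Proof.
move=> ab; rewrite predeqE => w; split=> [[[c d] [cd th] /=]|abw].
  by have -> : side a b = side c d by apply/theta_sideE.
by exists (a, b) => //; split => //; apply/theta_sideE.
Qed.

Lemma minus_side_class a b : adj a b ->
  minus_side (theta_class (a, b)) = ~` side a b.
Proof.
move=> ab; rewrite (sideC ab) predeqE => w; split=> [[[c d] [cd th]]|baw].
  have abcd : side a b = side c d by apply/theta_sideE.
  by rewrite -(sideC ab) abcd (sideC cd).
by exists (a, b) => //; split => //; apply/theta_sideE.
Qed.

Lemma theta_class_eq a b c d : adj a b -> adj c d ->
  side a b = side c d -> theta_class (a, b) = theta_class (c, d).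
Proof.
move=> ab cd abcd; rewrite predeqE => -[x y]; split=> -[xy th]; split=> //;
  apply/theta_sideE => //; have /theta_sideE := th; rewrite ?abcd; exact.
Qed.

Lemma theta_classP (h : set (M * M)) : theta_classes h ->
  exists a b, [/\ adj a b, h = theta_class (a, b),
    plus_side h = side a b & minus_side h = ~` side a b].
Proof.
move=> [[a b] ab <-]; exists a, b; split => //.
  exact: plus_side_class.
exact: minus_side_class.
Qed.

Lemma plus_side_inj (h k : set (M * M)) :
  theta_classes h -> theta_classes k -> plus_side h = plus_side k -> h = k.
Proof.
move=> /theta_classP[a [b [ab -> -> _]]] /theta_classP[c [d [cd -> -> _]]].
exact: theta_class_eq.
Qed.

Lemma minus_sideE (h : set (M * M)) : theta_classes h ->
  minus_side h = ~` plus_side h.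
Proof. by move=> /theta_classP[a [b [_ _ -> ->]]]. Qed.

Lemma halfspacesE : @halfspaces M = [set plus_side h | h in @theta_classes M].
Proof.
rewrite predeqE => H; split=> [[a [b [ab ->]]]|[h /theta_classP[a [b [ab _ e _]]] <-]].
  by exists (theta_class (a, b)); [exists (a, b) | exact: plus_side_class].
by exists a, b.
Qed.

Lemma halfspaces_crossing_bounded :
  graph_crossing_bounded M -> crossing_bounded (@set_cross M) (@halfspaces M).
Proof.
apply: (crossing_bounded_transfer
  (r := fun H h => theta_classes h /\ plus_side h = H)).
- by move=> H; rewrite halfspacesE => -[h hM <-]; exists h.
- by move=> H K h _ _ [_ <-] [_ <-].
- move=> H K h k [hM <-] [kM <-] [? ? ? ?].
  by split; rewrite ?minus_sideE.
Qed.

Lemma halfspaceC H : halfspaces H -> halfspaces (~` H).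
Proof.
by move=> [a [b [ab ->]]]; exists b, a; rewrite adj_sym sideC.
Qed.

(* The halfspaces separating [u] from [v] are the sides of the edges of a
   geodesic from [u] to [v]. *)
Lemma separating_halfspaces u v : exists s : seq (set M),
  [/\ uniq s, size s = gdist u v &
      [set` s] = [set H | [/\ halfspaces H, H u & ~ H v]]].
Proof.
move dE : (gdist u v) => n; elim: n u dE => [|n IHn] u duv.
  have -> := gdist_eq0 M_conn duv; exists [::]; split=> //.
  by rewrite predeqE => H; split => // -[].
have [|w uw duw] := geodesic_step M_conn (u := u) (v := v).
  by move=> uv; rewrite uv gdistxx in duv.
have dwv : gdist w v = n by lia.
have [s [us ss sE]] := IHn w dwv.
have nWw : ~ side u w w by rewrite /side /= gdistxx ltn0.
have nWv : ~ side u w v.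
  by rewrite /side /= (dC v u) (dC v w); lia.
exists (side u w :: s); split.
- rewrite /= us andbT; apply/negP => W.
  by have : [set` s] (side u w) by []; rewrite sE => -[_ /nWw].
- by rewrite /= ss.
- rewrite predeqE => H; rewrite /= inE; split=> [/predU1P[->|Hs]|].
    by split => //; [exists u, w | exact: side_left].
  have : [set` s] H by []; rewrite sE => -[HM Hw nHv]; split => //.
  case: HM Hw nHv => a [b [ab ->]] abw nabv; apply: contrapT => nabu.
  have bau : side b a u by rewrite -sideC.
  have wu : adj w u by rewrite adj_sym.
  have e := side_eq ab wu abw bau; apply: nabv; rewrite e /side /=.
  by rewrite (dC v u) (dC v w); lia.
- move=> [HM Hu nHv]; apply/predU1P.
  have [Hw|nHw] := pselect (H w).
    by right; have : [set H | [/\ halfspaces H, H w & ~ H v]] H by []; rewrite -sE.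
  left; case: HM Hu nHv nHw => a [b [ab ->]] abu nabv nabw.
  by apply: side_eq => //; rewrite -sideC.
Qed.
End Median.

(** * Separations induced by the halfspaces of a median graph *)

Lemma size_bounded_card_ge (T : eqType) (X : set T) n :
  ~ (`I_n #<= X) -> size_bounded X n.
Proof.
move=> nX s us sX; rewrite leqNgt; apply/negP => ns; apply: nX.
by apply/card_ge_seq; exists s; split => //; apply: ltnW.
Qed.

Lemma nat_cvg_infty (f : nat -> nat) :
  f @ \oo --> \oo <-> forall k, exists m, forall n, m <= n -> k <= f n.
Proof.
split=> [f_oo k|f_oo A [k _ kA]].
  have [m _ mP] : (f @ \oo) [set n | k <= n] by apply: f_oo; exists k.
  by exists m => n mn; apply: mP.
by have [m mP] := f_oo k; exists m => // n /= mn; apply/kA/mP.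
Qed.

Lemma increasing_separationsP (G : graph) (Sigma : set (set G * set G)) :
  (forall k, exists R, forall x y : G, R < gdist x y ->
    `I_k #<= [set s | [/\ Sigma s, (s.1 `\` s.2) x & (s.2 `\` s.1) y]]) ->
  increasing_separations Sigma.
Proof.
move=> SigmaP.
pose S x y := [set s | [/\ Sigma s, (s.1 `\` s.2) x & (s.2 `\` s.1) y]].
pose ok r k := `[< forall x y : G, r <= gdist x y -> `I_k #<= S x y >].
have ok0 r : ok r 0 by apply/asboolP => x y _; apply/card_ge_seq; exists [::].
(* Capping [k] at [r] makes the maximum exist even when every [k] is admissible, as happens if no
   two vertices are at distance [r] or more. *)
pose N r := \max_(k < r.+1 | ok r k) k.
exists N; last first.
  move=> r x y rxy; rewrite /N.
  have [|k] := @eq_bigmax_cond _ [pred k : 'I_r.+1 | ok r k] val.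
    by apply/card_gt0P; exists ord0; apply: (ok0 r).
  by move=> okk ->; have /asboolP := okk; apply.
apply/(nat_cvg_infty N) => k; have [R RP] := SigmaP k.
exists (maxn k R.+1) => r; rewrite geq_max => /andP[kr Rr].
rewrite /N.
have kr1 : k < r.+1 by lia.
apply: (@leq_bigmax_cond _ _ (fun k : 'I_r.+1 => val k) (Ordinal kr1)).
by apply/asboolP => x y rxy; apply: RP; apply: leq_trans rxy.
Qed.

Lemma act_imageE (Gamma : groupType) (G : graph) (a : graph_action Gamma G)
    g (X : set G) x : (a g @` X) x <-> X (a g^-1%g x).
Proof.
split=> [[y Xy <-]|Xx]; first by rewrite -actM mulVg act1.
by exists (a g^-1%g x) => //; rewrite -actM mulgV act1.
Qed.

Lemma act_imageC (Gamma : groupType) (G : graph) (a : graph_action Gamma G)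
    g (X : set G) : a g @` (~` X) = ~` (a g @` X).
Proof.
rewrite predeqE => x; rewrite act_imageE.
by split=> nX /=; [move/act_imageE | move=> Xx; apply/nX/act_imageE].
Qed.

Lemma halfspace_act (Gamma : groupType) (M : graph)
    (aM : graph_action Gamma M) : connected_graph M ->
  forall g (H : set M), halfspaces H -> halfspaces (aM g @` H).
Proof.
move=> M_conn g _ [a [b [ab ->]]]; exists (aM g a), (aM g b).
rewrite act_adj; split => //; rewrite predeqE => w; rewrite act_imageE /side /=.
have e c : gdist (aM g^-1%g w) c = gdist w (aM g c).
  by rewrite -(gdist_act aM M_conn g) -actM mulgV act1.
by rewrite !e.
Qed.

(** A walk from [A] to a vertex outside [A] leaves [A] along some edge. Its far end lies in [B] but
    not in [A], so its near end must lie in [B] too. *)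
Lemma separation_meet (G : graph) (s : set G * set G) : connected_graph G ->
  is_separation s -> essential s -> exists x, (s.1 `&` s.2) x.
Proof.
case: s => A B G_conn [/= AB sepAB] [/= AV BV]; apply: contrapT => ABx.
have [b nAb] : exists b, ~ A b.
  by apply: contrapT => nA; apply: AV; rewrite predeqE => x; split => // _;
    apply: contrapT => nAx; apply: nA; exists x.
have [a nBa] : exists a, ~ B a.
  by apply: contrapT => nB; apply: BV; rewrite predeqE => x; split => // _;
    apply: contrapT => nBx; apply: nB; exists x.
have ABC x : A x \/ B x by have : (A `|` B) x by rewrite AB.
have {nBa} Aa : A a by case: (ABC a).
have [p /andP[pp /eqP lp]] := G_conn a b.
elim: p a Aa pp lp => [|x p IHp] a Aa /=; first by move=> _ e; apply: nAb; rewrite -e.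
move=> /andP[ax px]; apply: IHp => //.
apply: contrapT => nAx; have Bx : B x by case: (ABC x).
have nBa : ~ B a by move=> Ba; apply: ABx; exists a.
by have := sepAB a x (conj Aa nBa) (conj Bx nAx); rewrite ax.
Qed.

(** * Separations traced by halfspaces on bounded sets *)

Section ThickenedSeparations.
Variables (G M : graph) (F : G -> set M).
Hypotheses (G_conn : connected_graph G) (M_med : median_graph M).
Hypothesis M_bounded : graph_crossing_bounded M.
Hypothesis F0 : forall x, F x !=set0.
Hypothesis F_adj : forall x y, adj x y -> F x `&` F y !=set0.
Variable D : nat.
Hypothesis F_diam : forall x, diam_le (F x) D.

Definition trace (H : set M) : set G := [set x | F x `&` H !=set0].

Definition trace_sep (H : set M) : set G * set G := (trace H, trace (~` H)).

Definition trace_seps : set (set G * set G) :=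
  [set s | essential s /\ exists2 H, halfspaces H & s = trace_sep H].

Let M_conn : connected_graph M. Proof. by case: M_med. Qed.

Lemma traceS H K : H `<=` K -> trace H `<=` trace K.
Proof. by move=> HK x [u [Fu Hu]]; exists u; split=> //; apply: HK. Qed.

Lemma ntrace H x : ~ trace (~` H) x <-> F x `<=` H.
Proof.
split=> [nt u Fu|FH [u [Fu nHu]]]; last exact/nHu/FH.
by apply: contrapT => nHu; apply: nt; exists u.
Qed.

Lemma ntraceC H x : ~ trace H x <-> F x `<=` ~` H.
Proof. by rewrite -{1}(setCK H) ntrace. Qed.

Lemma trace_sepC H : trace_sep (~` H) = flip (trace_sep H).
Proof. by rewrite /trace_sep setCK. Qed.

Lemma trace_sepP H : is_separation (trace_sep H).
Proof.
split=> [|x y [_ /ntrace Hx] [_ /ntraceC Hy]].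
  rewrite predeqE => x; split=> // _; have [u Fu] := F0 x.
  by have [Hu|nHu] := pselect (H u); [left | right]; exists u.
by apply/negP => /F_adj[u [/Hx Hu /Hy]].
Qed.

Lemma trace_seps_system : separation_system trace_seps.
Proof.
move=> s [+ [H HM e]]; rewrite {}e => ess; split=> //.
- exact: trace_sepP.
- split; first by case: ess.
  by exists (~` H); [exact: halfspaceC | rewrite trace_sepC].
Qed.

Lemma not_set_cross (H K : set M) : ~ set_cross H K ->
  [\/ H `<=` K, K `<=` H, H `<=` ~` K | ~` H `<=` K].
Proof.
move=> HK; apply: contrapT => nHK; apply: HK.
have I0 (A B : set M) : ~ (A `<=` B) -> A `&` ~` B !=set0.
  move=> nAB; apply: contrapT => AB0; apply: nAB => x Ax.
  by apply: contrapT => nBx; apply: AB0; exists x.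
split.
- rewrite -{1}(setCK K); apply: I0 => ?; apply: nHK; exact: Or43.
- by apply: I0 => ?; apply: nHK; exact: Or41.
- by rewrite setIC; apply: I0 => ?; apply: nHK; exact: Or42.
- by apply: I0 => ?; apply: nHK; exact: Or44.
Qed.

(** Traces are monotone and complements become flips, so each way for [H] and [K] to be nested makes
    their separations nested. *)
Lemma trace_sep_cross H K :
  sep_cross (trace_sep H) (trace_sep K) -> set_cross H K.
Proof.
move=> cr; apply: contrapT => /not_set_cross HK; apply: cr; case: HK => HK.
- by left; left; split; apply: traceS => //; apply: subsetC.
- by left; right; split; apply: traceS => //; apply: subsetC.
- right; left; split; apply: traceS => //=.
  by rewrite -{1}(setCK K); apply: subsetC.
- right; right; split; apply: traceS => //=.
  by rewrite -(setCK H); apply: subsetC.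
Qed.

Lemma trace_seps_crossing_bounded : sep_crossing_bounded trace_seps.
Proof.
have := halfspaces_crossing_bounded M_med M_bounded.
apply: (crossing_bounded_transfer
  (r := fun s H => s = trace_sep H)) => [s [_ [H HM ->]]|s t H _ _ -> ->|] //.
  by exists H.
by move=> s t H K -> ->; apply: trace_sep_cross.
Qed.

Lemma essentialP (s : set G * set G) : s.1 `|` s.2 = setT -> essential s ->
  (exists x, (s.1 `\` s.2) x) /\ (exists y, (s.2 `\` s.1) y).
Proof.
case: s => A B /= AB [AV BV].
have ABC x : A x \/ B x by have : (A `|` B) x by rewrite AB.
have I0 (X Y : set G) : (forall x, X x \/ Y x) -> Y <> setT ->
    exists x, (X `\` Y) x.
  move=> XY YV; apply: contrapT => XY0; apply: YV; rewrite predeqE => x.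
  split=> // _; apply: contrapT => nYx; apply: XY0; exists x; split => //.
  by case: (XY x).
by split; apply: I0 => // x; case: (ABC x); [right | left].
Qed.

Lemma separating_bounded u v :
  size_bounded [set H | [/\ @halfspaces M H, H u & ~ H v]] (gdist u v).
Proof.
have [s [us <- <-]] := separating_halfspaces M_med u v.
exact: size_bounded_seq.
Qed.

(** Fix [u] in [F x] and [v] in [F y]: a halfspace inducing such a separation separates [u] from
    [v], and there are only [gdist u v] of those. *)
Lemma trace_seps_between x y : finite_set
  [set s | [/\ trace_seps s, (s.1 `\` s.2) x & (s.2 `\` s.1) y]].
Proof.
have [[u Fu] [v Fv]] := (F0 x, F0 y).
apply/finite_size_bounded; exists (gdist u v).
apply: (size_bounded_inj (r := fun s H => s = trace_sep H)) 
  (@separating_bounded u v) => [s|s t H _ _ -> ->//].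
move=> [[_ [H HM ->]] [_ xH] [_ yH]]; exists H => //; split=> //.
  by move/ntrace: xH; apply.
by move/ntraceC: yH; apply.
Qed.

(** A vertex strictly on the first side of [s] and one strictly on the second side of [t] are
    separated by everything between [s] and [t]. *)
Lemma trace_seps_discrete : sep_discrete trace_seps.
Proof.
move=> s t /trace_seps_system[[sV _] es _] /trace_seps_system[[tV _] et _].
have [[x [sx nsx]] _] := essentialP sV es.
have [_ [y [ty nty]]] := essentialP tV et.
apply: sub_finite_set (trace_seps_between x y) => z [Sz [sz zs] [zt tz]].
split=> //; split; by [apply: sz | apply: tz | move=> /zs | move=> /zt].
Qed.

(** A vertex [y] strictly on the second side of the first separation stays there along the chain, so
    a point [x] of the intersection would be separated from [y] by infinitely many separations. *)
Lemma trace_seps_ECC : ECC trace_seps.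
Proof.
move=> s sS s_desc; rewrite predeqE => x; split=> // sx.
have s_le m n : m <= n -> sep_le (s n) (s m).
  elim: n => [|n IHn]; first by rewrite leqn0 => /eqP->; split.
  rewrite leq_eqVlt => /predU1P[->|/IHn[sm ms]]; first by split.
  have [[sn ns] _] := s_desc n.
  by split; [exact: subset_trans sm | exact: subset_trans ns].
have s_inj : injective s.
  suff lt m n : m < n -> s m <> s n.
    by move=> m n e; case: (ltngtP m n) => // /lt; rewrite e.
  move=> mn e; have [[s1 s2] s12] := s_desc m; apply: s12.
  have [s3 s4] := s_le _ _ mn; rewrite -e in s3 s4.
  have e1 : (s m.+1).1 = (s m).1 by rewrite eqEsubset.
  have e2 : (s m.+1).2 = (s m).2 by rewrite eqEsubset.
  by rewrite [LHS]surjective_pairing e1 e2 -surjective_pairing.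
have [[sV _] es _] := trace_seps_system (sS 0).
have [_ [y [sy nsy]]] := essentialP sV es.
have /finite_size_bounded[n] := trace_seps_between x y.
move=> /(_ (map s (iota 0 n.+1))); rewrite size_map size_iota ltnn => h.
suff : false by []; apply: h; first by rewrite map_inj_uniq ?iota_uniq.
move=> t /mapP[i _ ->].
have [s1 s2] := s_le 0 i (leq0n i).
by split => //; [exact: sx | split; [exact: s2 | move=> /s1]].
Qed.

Definition set_lt : rel (set M) := fun H K => `[< H `<=` K /\ H <> K >].

Lemma set_lt_trans : transitive set_lt.
Proof.
move=> K H L /asboolP[HK nHK] /asboolP[KL nKL]; apply/asboolP.
split; first exact: subset_trans KL.
by move=> HL; apply: nHK; rewrite eqEsubset; split=> //; rewrite HL.
Qed.

Lemma set_lt_irr : irreflexive set_lt.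
Proof. by move=> H; apply/asboolP => -[_]. Qed.

(** In a chain of halfspaces cutting [P], a point of [P] in the least and one outside the greatest
    are separated by every member, so the length is at most [D]. The last hypothesis excludes
    halfspaces that are merely disjoint or jointly cover [M], so antichains consist of pairwise
    crossing halfspaces. *)
Lemma cut_halfspaces_bounded : exists N, forall (P : set M) (X : set (set M)),
    diam_le P D -> X `<=` @halfspaces M ->
    (forall H, X H -> P `&` H !=set0 /\ P `&` ~` H !=set0) ->
    (forall H K, X H -> X K -> [\/ set_cross H K, H `<=` K | K `<=` H]) ->
  size_bounded X N.
Proof.
have [N MN] := halfspaces_crossing_bounded M_med M_bounded.
exists (D * N) => P X PD XM Xcut Xcomp.
apply: (@size_bounded_chain_antichain _ set_lt).
- exact: set_lt_trans.
- exact: set_lt_irr.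
- case=> // H c cH cX.
  have minH K : K \in H :: c -> H `<=` K.
    move: (order_path_min set_lt_trans cH) => /allP Hc.
    by rewrite inE => /predU1P[->//|/Hc /asboolP[]].
  have maxL : forall K, K \in H :: c -> K `<=` last H c.
    elim: c H cH {cX minH} => [|L c IHc] H /=; first by move=> _ K /[1!inE] /eqP->.
    move=> /andP[/asboolP[HL _] Lc] K; rewrite inE => /predU1P[->|/(IHc L Lc)//].
    by apply: subset_trans HL _; apply: (IHc L) => //; rewrite mem_head.
  have [[u [Pu Hu]] _] := Xcut H (cX _ (mem_head _ _)).
  have [_ [v [Pv nLv]]] := Xcut (last H c) (cX _ (mem_last _ _)).
  apply: leq_trans (PD u v Pu Pv); apply: separating_bounded.
    exact: (sorted_uniq set_lt_trans set_lt_irr cH).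
  move=> K Kc; split; first exact/XM/cX.
    exact: minH Kc _ Hu.
  by move=> /(maxL K Kc).
- move=> c uc cX clt.
  apply: ((card_le_size_bounded [set` c] N).1 _ c uc) => //.
  apply: MN (subset_trans cX XM) _.
  move=> H K Hc Kc HK; case: (Xcomp H K (cX _ Hc) (cX _ Kc)) => // le.
    by have /asboolP[] := clt H K Hc Kc.
  by have /asboolP[] := clt K H Kc Hc; split => // /esym.
Qed.

(** Essentiality provides a vertex [z] with [F z] inside [H]. If the separation of [H] is below that
    of [K], then [F z] meets [K], so [H] and [K] are not disjoint; dually their complements are not
    disjoint either. *)
Lemma trace_sep_comparable H K :
    essential (trace_sep H) -> essential (trace_sep K) ->
    sep_comparable (trace_sep H) (trace_sep K) ->
  [\/ set_cross H K, H `<=` K | K `<=` H].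
Proof.
suff le H' K' : essential (trace_sep H') -> essential (trace_sep K') ->
    sep_le (trace_sep H') (trace_sep K') ->
    [\/ set_cross H' K', H' `<=` K' | K' `<=` H'].
  move=> eH eK [HK|KH]; first exact: le.
  case: (le _ _ eK eH KH) => [[h1 h2 h3 h4]|?|?].
  - by apply: Or31; split; rewrite setIC.
  - exact: Or33.
  - exact: Or32.
move=> eH eK [/= HK KH].
have [HV _] := trace_sepP H'; have [KV _] := trace_sepP K'.
have [cr|/not_set_cross] := pselect (set_cross H' K'); first exact: Or31.
case=> [?|?|HnK|nHK]; [exact: Or32 | exact: Or33 | exfalso..].
  have [[z [zH /ntrace zH']] _] := essentialP HV eH.
  by have [u [Fu Ku]] := HK _ zH; apply: HnK Ku; apply: zH'.
have [_ [z [zK /ntraceC zK']]] := essentialP KV eK.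
by have [u [Fu nHu]] := KH _ zK; apply: (zK' u Fu); apply: nHK.
Qed.

Lemma trace_seps_width : uniform_local_width trace_seps.
Proof.
have [N NP] := cut_halfspaces_bounded.
have [N' N'P] := trace_seps_crossing_bounded.
exists (N + N') => x X XS [Xc|Xc]; last first.
  apply/card_le_size_bounded; apply: (@size_boundedW _ _ X N') => //.
    by rewrite leq_addl.
  by apply/card_le_size_bounded/N'P => // s /XS[].
apply/card_le_size_bounded; apply: (@size_boundedW _ _ X N) => //.
  by rewrite leq_addr.
apply: (@size_bounded_inj _ _ (fun s H => s = trace_sep H) _
    [set H | halfspaces H /\ X (trace_sep H)]).
- by move=> s Xs; have [[_ [H HM e]] _] := XS s Xs; exists H => //=; rewrite -e.
- by move=> s t H _ _ -> ->.
- apply: (NP (F x)) => //; first by move=> H [].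
    by move=> H [_ /XS[_ []]].
  move=> H K [_ XH] [_ XK]; have [[eH _] _] := XS _ XH.
  have [[eK _] _] := XS _ XK; apply: trace_sep_comparable => //.
  have [e|HK] := pselect (trace_sep H = trace_sep K).
    by rewrite e; left; split.
  exact: Xc.
Qed.

(** Of the halfspaces separating [u] from [v], at most [N] cut [F x] and at most [N] cut [F y]. Each
    other one induces a separation of [x] from [y]; those inducing the same separation all cut [F z]
    for a common [z] on both its sides, so there are at most [N] of them. *)
Lemma trace_seps_separating : exists N, forall x y u v n, F x u -> F y v ->
    size_bounded
      [set s | [/\ trace_seps s, (s.1 `\` s.2) x & (s.2 `\` s.1) y]] n ->
  gdist u v <= n * N + (N + N).
Proof.
have [N NP] := cut_halfspaces_bounded; exists N => x y u v n Fu Fv Sb.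
have [s [us <- sE]] := separating_halfspaces M_med u v.
pose S := [set H | [/\ @halfspaces M H, H u & ~ H v]].
have SE : S = [set` s] by [].
have Scomp H K : S H -> S K -> [\/ set_cross H K, H `<=` K | K `<=` H].
  move=> [_ Hu nHv] [_ Ku nKv].
  have [cr|/not_set_cross] := pselect (set_cross H K); first exact: Or31.
  case=> [?|?|/(_ _ Hu)//|/(_ _ nHv)//]; [exact: Or32 | exact: Or33].
have b1 : size_bounded (S `&` [set H | trace (~` H) x]) N.
  apply: (NP (F x)) => //; first by move=> H [[]].
    by move=> H [[_ Hu _] tH]; split => //; exists u.
  by move=> H K [SH _] [SK _]; apply: Scomp.
have b2 : size_bounded (S `&` [set H | trace H y]) N.
  apply: (NP (F y)) => //; first by move=> H [[]].
    by move=> H [[_ _ nHv] tH]; split => //; exists v.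
  by move=> H K [SH _] [SK _]; apply: Scomp.
have b3 : size_bounded (S `&` [set H | F x `<=` H /\ F y `<=` ~` H]) (n * N).
  apply: (@size_bounded_fibres _ _ (fun H s => s = trace_sep H) _ _ _ _ _ _ Sb).
    move=> H [[HM Hu nHv] [xH yH]]; exists (trace_sep H) => //.
    have nxH : ~ trace (~` H) x by apply/ntrace.
    have nyH : ~ trace H y by apply/ntraceC.
    split; [|split=> //=; by exists u|split=> //=; by exists v].
    split; last by exists H.
    by split=> /= e; [apply: nyH | apply: nxH]; rewrite e.
  move=> t [tS xt yt].
  have [t_sep et _] := trace_seps_system tS.
  have [z [tz1 tz2]] := separation_meet G_conn t_sep et.
  apply: (NP (F z)) => //; first by move=> H [[[]]].
    by move=> H [_ e]; rewrite e in tz1 tz2.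
  by move=> H K [[SH _] _] [[SK _] _]; apply: Scomp.
have b := size_boundedU b3 (size_boundedU b1 b2).
apply: b => // H; rewrite -SE => SH.
have [tx|/ntrace tx] := pselect (trace (~` H) x); first by right; left.
have [ty|/ntraceC ty] := pselect (trace H y); first by right; right.
by left.
Qed.

Lemma trace_seps_increasing :
    (forall r, exists R, forall x y u v, F x u -> F y v -> gdist u v <= r ->
      gdist x y <= R) ->
  increasing_separations trace_seps.
Proof.
move=> Fproper; apply: increasing_separationsP => k.
have [N NP] := trace_seps_separating.
have [R RP] := Fproper (k * N + (N + N)); exists R => x y xyR.
apply: contrapT => /size_bounded_card_ge Sb.
have [[u Fu] [v Fv]] := (F0 x, F0 y).
by move: xyR; rewrite ltnNge (RP x y u v)//; apply: NP Sb.
Qed.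

Lemma trace_seps_invariant (Gamma : groupType) (aG : graph_action Gamma G)
    (aM : graph_action Gamma M) :
  (forall g x, F (aG g x) = aM g @` F x) -> sep_invariant aG trace_seps.
Proof.
move=> Fact g s [+ [H HM e]]; rewrite {s}e => -[/= HV nHV].
have traceE K : aG g @` trace K = trace (aM g @` K).
  rewrite predeqE => x; rewrite act_imageE; split.
    move=> [u [Fu Ku]]; exists (aM g u); split; last by exists u.
    by rewrite -(act1 aG x) -(mulgV g) actM Fact; exists u.
  move=> [u [Fu /act_imageE Ku]]; exists (aM g^-1%g u); split=> //.
  by rewrite Fact; exists u.
split; last first.
  exists (aM g @` H); first exact: halfspace_act.
  by rewrite /trace_sep -act_imageC !traceE.
have gT (X : set G) : aG g @` X = setT -> X = setT.
  move=> gX; rewrite predeqE => x; split=> // _.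
  have : (aG g @` X) (aG g x) by rewrite gX.
  by rewrite act_imageE -actM mulVg act1.
by split=> /= /gT.
Qed.

End ThickenedSeparations.

(** * The median graph dual to a pocset *)

Record pocset := Pocset {
  poc :> choiceType;
  ple : poc -> poc -> Prop;
  pneg : poc -> poc;
  ple_refl : forall s, ple s s;
  ple_trans : forall t s u, ple s t -> ple t u -> ple s u;
  ple_anti : forall s t, ple s t -> ple t s -> s = t;
  pnegK : involutive pneg;
  ple_neg : forall s t, ple s t -> ple (pneg t) (pneg s);
  ple_negF : forall s, ~ ple s (pneg s) }.

Definition pcross (P : pocset) (s t : P) : Prop :=
  ~ [\/ ple s t, ple t s, ple s (pneg t) | ple (pneg t) s].

Definition up_closed (P : pocset) (w : set P) : Prop :=
  forall s t, w s -> ple s t -> w t.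

(** These are the ultrafilters of the pocset in Roller's duality. *)
Definition orientation (P : pocset) (w : set P) : Prop :=
  up_closed w /\ forall s, w (pneg s) <-> ~ w s.

(** By Zorn's lemma there is a maximal consistent up-closed extension. If it contained neither [s]
    nor [pneg s], everything above [s] could be added to it. *)
Lemma orientation_extend (P : pocset) (Q : set P) :
    up_closed Q -> (forall s, Q s -> ~ Q (pneg s)) ->
  exists2 w, orientation w & Q `<=` w.
Proof.
move=> Qup Qcons.
(* The condition is put on the union with [Q], so that the empty union of an empty chain satisfies
   it. *)
pose ok := [set X : set P | up_closed (Q `|` X) /\
  forall s, (Q `|` X) s -> ~ (Q `|` X) (pneg s)].
have [F Fok Ftot|A [[Aup Acons] Amax]] := @Zorn_bigcup P ok.
  have pick s t : (Q `|` \bigcup_(X in F) X) s -> (Q `|` \bigcup_(X in F) X) t ->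
      exists X, [/\ ok X, (Q `|` X) s, (Q `|` X) t &
        X `<=` \bigcup_(X in F) X].
    have ok0 : ok set0 by split; rewrite setU0.
    have inF X : F X -> X `<=` \bigcup_(X in F) X by move=> FX x Xx; exists X.
    move=> [Qs|[X FX Xs]] [Qt|[Y FY Yt]].
    - by exists set0; split => //; left.
    - by exists Y; split; [exact: Fok | left | right | exact: inF].
    - by exists X; split; [exact: Fok | right | left | exact: inF].
    - case: (Ftot X Y FX FY) => le; [exists Y | exists X]; split;
        by [exact: Fok | right; apply: le | right | exact: inF].
  split=> [s t us st|s us uns].
    have [X [[Xup _] Xs _ XF]] := pick s s us us.
    by case: (Xup s t Xs st) => [Qt|/XF Ft]; [left | right].
  by have [X [[_ Xc] Xs Xns _]] := pick _ _ us uns; apply: (Xc s).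
exists (Q `|` A); last by move=> s Qs; left.
split=> // s; split=> [ns QAs|nQAs]; first exact: Acons QAs ns.
apply: contrapT => nQAns.
pose B := A `|` [set t | ple s t].
have AB : A `<` B.
  split; first by move=> t At; left.
  by move=> /(_ s) h; apply: nQAs; right; apply: h; right; apply: ple_refl.
apply: (Amax B AB).
suff : up_closed (Q `|` B) /\ forall t, (Q `|` B) t -> ~ (Q `|` B) (pneg t) by [].
rewrite /B setUA; split=> [t u [Qt|st] tu|t [Qt|st] [Qnt|snt]].
- by left; apply: Aup tu.
- by right; apply: ple_trans tu.
- exact: Acons Qt Qnt.
- apply: nQAns; apply: Aup Qt _.
  by rewrite -(pnegK t); apply: ple_neg.
- apply: nQAns; apply: Aup Qnt _; exact: ple_neg.
- apply: (@ple_negF P s); apply: ple_trans st _.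
  by rewrite -(pnegK t); apply: ple_neg.
Qed.

(** * Differences of orientations *)

Section OrientationDifference.
Variable P : pocset.
Implicit Types u v w : set P.

Lemma orientation_nd u v s : orientation u -> orientation v ->
  (u `\` v) s <-> (v `\` u) (pneg s).
Proof.
move=> [_ uN] [_ vN]; split=> -[h1 h2].
  by split; [apply/vN | move=> /uN; apply].
by split; [apply: contrapT => /uN | apply/vN].
Qed.

Lemma orientation_diff_finite u v : orientation u -> orientation v ->
  finite_set (u `\` v) -> finite_set (v `\` u).
Proof.
move=> ou ov fuv; apply: sub_finite_set (finite_image (@pneg P) fuv) => s sd.
exists (pneg s); last exact: pnegK.
by apply/(orientation_nd _ ov ou).1.
Qed.

Lemma setD_triangle u v w : u `\` w `<=` (u `\` v) `|` (v `\` w).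
Proof.
by move=> s [us nws]; have [vs|nvs] := pselect (v s); [right | left].
Qed.

Lemma setD_finite_trans v u w :
  finite_set (u `\` v) -> finite_set (v `\` w) -> finite_set (u `\` w).
Proof.
move=> uv vw; apply: sub_finite_set (@setD_triangle u v w) _.
by rewrite finite_setU.
Qed.

(** Having [s] below [pneg t] would contradict that [u] contains both elements, and [pneg t] below
    [s] that [v] contains neither. *)
Lemma orientation_diff_nested u v s t : orientation u -> orientation v ->
  (u `\` v) s -> (u `\` v) t -> [\/ pcross s t, ple s t | ple t s].
Proof.
move=> [uup uN] [vup vN] [us nvs] [ut nvt].
have [cr|/contrapT] := pselect (pcross s t); first exact: Or31.
case=> [?|?|snt|nts]; [exact: Or32 | exact: Or33 | exfalso..].
  by move/(uN t): (uup _ _ us snt).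
by apply: nvs; apply: vup nts; apply/vN.
Qed.

(** As [v] is up-closed, whatever [u] contains below [s] also lies outside [v]. So [s] is minimal in
    all of [u], and replacing it by its complement keeps the set up-closed. *)
Lemma flip_minimal_orientation u v s : orientation u -> orientation v ->
    (u `\` v) s -> (forall t, (u `\` v) t -> ple t s -> t = s) ->
  orientation ((u `\ s) `|` [set pneg s]).
Proof.
move=> [uup uN] [vup vN] [us nvs] smin.
have nss : pneg s <> s by move=> e; apply: (@ple_negF P s); rewrite e; exact: ple_refl.
have keep t : u t -> ple t s -> t = s.
  by move=> ut ts; apply: smin => //; split=> // vt; apply: nvs; apply: vup ts.
split=> [t r [[ut ts]|->] tr|t].
- left; split; first exact: uup tr.
  by move=> rs; apply: ts; apply: keep; rewrite -?rs.
- have [->|rns] := pselect (r = pneg s); first by right.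
  have nrs : ple (pneg r) s by rewrite -(pnegK s); apply: ple_neg.
  left; split.
    apply: contrapT => /uN /keep -/(_ nrs) e.
    by apply: rns; rewrite -e pnegK.
  by move=> e; apply: (@ple_negF P (pneg s)); rewrite pnegK -{2}e.
- split=> [[[/uN nut nts]|nts] [[ut ts]|ts]|h].
  + by [].
  + by apply: nts; rewrite ts pnegK.
  + by apply: ts; rewrite -(pnegK t) nts pnegK.
  + by apply: nss; rewrite -ts -(pnegK t) nts pnegK.
  + have [->|ts] := pselect (t = s); first by right.
    left; split.
      by apply/uN => ut; apply: h; left.
    by move=> nts; apply: h; right; rewrite -nts pnegK.
Qed.

End OrientationDifference.

(** * The dual graph: metric, medians and halfspaces *)

Section Dual.
Variables (P : pocset) (B : set (set P)).

Definition dual_vertex : Type :=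
  {w : set P | `[< orientation w /\ exists2 b, B b & finite_set (w `\` b) >]}.

(** One difference suffices, since complementation carries it onto the other one. *)
Definition dual_adj : rel dual_vertex :=
  fun u v => `[< exists s, val u `\` val v = [set s] >].

Lemma dual_orientation (u : dual_vertex) : orientation (val u).
Proof. by have /asboolP[] := valP u. Qed.

Lemma dual_adj_sym : symmetric dual_adj.
Proof.
suff imp u v : dual_adj u v -> dual_adj v u by move=> u v; apply/idP/idP; apply: imp.
move=> /asboolP[s e]; apply/asboolP; exists (pneg s).
rewrite predeqE => t.
rewrite (orientation_nd t (dual_orientation v) (dual_orientation u)) e /=.
by split=> [<-|->]; rewrite pnegK.
Qed.

Lemma dual_adj_irr : irreflexive dual_adj.
Proof.
move=> u; apply/asboolP => -[s]; rewrite setDv => /seteqP[_ /(_ s)].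
exact.
Qed.

Definition dual_graph : graph := Graph dual_adj_sym dual_adj_irr.

Lemma dual_vertex_intro (w b : set P) : orientation w -> B b ->
  finite_set (w `\` b) -> exists u : dual_graph, val u = w.
Proof.
move=> ow Bb fwb.
have h : `[< orientation w /\ exists2 b, B b & finite_set (w `\` b) >].
  by apply/asboolP; split => //; exists b.
by exists (exist _ w h).
Qed.

Hypothesis B_or : forall b, B b -> orientation b.
Hypothesis B_fin : forall b b', B b -> B b' -> finite_set (b `\` b').
Implicit Types u v w : dual_graph.

Lemma dual_diff_finite u v : finite_set (val u `\` val v).
Proof.
have /asboolP[ou [b Bb ub]] := valP u; have /asboolP[ov [c Bc vc]] := valP v.
apply: (setD_finite_trans ub); apply: (setD_finite_trans (B_fin Bb Bc)).
exact: orientation_diff_finite (B_or Bc) vc.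
Qed.

Lemma dual_diff_enum u v :
  exists2 s : seq P, uniq s & val u `\` val v = [set` s].
Proof.
have /finite_size_bounded[n] := dual_diff_finite u v.
exact: size_bounded_enum.
Qed.

Lemma dual_diff0 u v : val u `\` val v = set0 -> u = v.
Proof.
move=> uv0; apply: val_inj; rewrite eqEsubset; split=> s.
  by move=> us; apply: contrapT => nvs; have : set0 s by rewrite -uv0.
move=> vs; apply: contrapT => nus.
have : (val u `\` val v) (pneg s).
  apply/(orientation_nd s (dual_orientation v) (dual_orientation u)).1.
  by split.
by rewrite uv0.
Qed.

Lemma seq_minimal (T : eqType) (le : T -> T -> Prop) (x : T) (s : seq T) :
    (forall y, le y y) -> (forall y x z, le x y -> le y z -> le x z) ->
    (forall x y, le x y -> le y x -> x = y) ->
  exists2 m, m \in x :: s & forall y, y \in x :: s -> le y m -> y = m.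
Proof.
move=> le_refl le_trans le_anti.
elim: s x => [|y s IHs] x.
  by exists x => [|y]; rewrite inE // => /eqP.
have [m ms mmin] := IHs y.
have [xm|nxm] := pselect (le x m); last first.
  exists m => [|z]; rewrite inE; first by rewrite ms orbT.
  by move=> /predU1P[->//|]; apply: mmin.
exists x => [|z]; rewrite inE ?eqxx// => /predU1P[//|zs zx].
have zm := mmin z zs (le_trans _ _ _ zx xm).
by rewrite zm in zx *; apply: le_anti.
Qed.

(** Flipping a minimal element of the difference yields a neighbour of [u] that is one element
    closer to [v]. *)
Lemma dual_step u v (s : seq P) : uniq s -> val u `\` val v = [set` s] ->
  s <> [::] -> exists w (t : seq P),
    [/\ adj u w, uniq t, val w `\` val v = [set` t] & size s = (size t).+1].
Proof.
case: s => // x s us uvE _.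
have inE' y : y \in x :: s <-> (val u `\` val v) y by rewrite uvE.
have [m ms mmin] := @seq_minimal P (@ple P) x s (@ple_refl P) (@ple_trans P)
  (@ple_anti P).
have md : (val u `\` val v) m by rewrite uvE.
have [um nvm] := md.
have [ou ov] := (dual_orientation u, dual_orientation v).
have ow : orientation ((val u `\ m) `|` [set pneg m]).
  apply: (flip_minimal_orientation ou ov md) => t.
  by rewrite uvE; apply: mmin.
have nmm : pneg m <> m by move=> e; apply: (@ple_negF P m); rewrite e; exact: ple_refl.
have uwE : val u `\` (val u `\ m `|` [set pneg m]) = [set m].
  rewrite predeqE => t; split=> [[ut nt]|->].
    by apply: contrapT => tm; apply: nt; left.
  split=> // -[[_ /(_ erefl)//]|e]; exact: nmm.
have /asboolP[_ [b Bb ub]] := valP u.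
have [|w wE] := dual_vertex_intro ow Bb.
  apply: (setD_finite_trans (v := val u)) => //.
  apply: orientation_diff_finite ou ow _; rewrite uwE; exact: finite_set1.
exists w, (rem m (x :: s)); split.
- by apply/asboolP; exists m; rewrite wE.
- exact: rem_uniq.
- have remE t : t \in rem m (x :: s) = (t != m) && (t \in x :: s).
    by rewrite mem_rem_uniq// inE.
  rewrite wE predeqE => t; split=> [[utm nvt]|].
    suff : t \in rem m (x :: s) by [].
    case: utm => [[ut tm]|tm]; last by case: nvt; rewrite tm; apply/(ov.2 m).
    by rewrite remE; apply/andP; split; [apply/eqP | apply/inE'].
  move=> ts; have {ts} : t \in rem m (x :: s) by [].
  by rewrite remE => /andP[/eqP tm /inE'[ut nvt]]; split => //; left.
- by rewrite size_rem// prednK.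
Qed.

Lemma dual_walk u v (s : seq P) : uniq s -> val u `\` val v = [set` s] ->
  exists2 p, walk u v p & size p = size s.
Proof.
move nE : (size s) => n; elim: n u s nE => [|n IHn] u s ss us uvE.
  exists [::] => //; rewrite /walk /=; apply/eqP/dual_diff0.
  by rewrite uvE (size0nil ss) set_nil.
have [|w [t [uw ut wvE st]]] := dual_step us uvE; first by move=> s0; rewrite s0 in ss.
have [|p /andP[pp lp] sp] := IHn w t _ ut wvE; first by lia.
exists (w :: p); last by rewrite /= sp.
by apply/andP; split=> //=; apply/andP.
Qed.

Lemma dual_connected : connected_graph dual_graph.
Proof.
move=> u v; have [s us uvE] := dual_diff_enum u v.
by have [p wp _] := dual_walk us uvE; exists p.
Qed.

Lemma dual_walk_diff u v p : walk u v p ->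
  size_bounded (val u `\` val v) (size p).
Proof.
elim: p u => [|x p IHp] u; rewrite /walk /=.
  move=> /eqP <- s us; rewrite setDv; case: s us => // t s _ sX.
  by have [] : set0 t by apply: sX; rewrite /= mem_head.
move=> /andP[/andP[/asboolP[s uxE] px] lp].
apply: (size_boundedW (@setD_triangle P (val u) (val x) (val v)) (leqnn _)).
rewrite -add1n; apply: size_boundedU; last by apply: IHp; rewrite /walk px lp.
rewrite uxE (_ : [set s] = [set` [:: s]]); first exact: (@size_bounded_seq _ [:: s]).
by rewrite predeqE => t /=; rewrite inE; split=> [->|/eqP].
Qed.

Lemma dual_gdist_bounded u v : size_bounded (val u `\` val v) (gdist u v).
Proof.
have [p /andP[wp /eqP <-]] := geodesic_exists dual_connected u v.
exact: dual_walk_diff.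
Qed.

(** Flipping the elements of the difference one by one gives a walk of this length, and no walk is
    shorter because each edge changes a single element. *)
Lemma dual_gdistE u v (s : seq P) : uniq s -> val u `\` val v = [set` s] ->
  gdist u v = size s.
Proof.
move=> us uvE; apply/eqP; rewrite eqn_leq; apply/andP; split.
  by have [p wp <-] := dual_walk us uvE; apply: gdist_le.
by apply: dual_gdist_bounded; rewrite ?uvE.
Qed.

Lemma dual_gdist_le u v n :
  size_bounded (val u `\` val v) n -> gdist u v <= n.
Proof.
have [s us uvE] := dual_diff_enum u v.
by rewrite (dual_gdistE us uvE); apply; rewrite ?uvE.
Qed.

(** An element of [u] and [v] missing from [w] would be flipped and flipped back on the way through
    [w], making the detour longer. Otherwise the difference of [u] and [v] is the disjoint union of
    the two partial differences. *)
Lemma dual_interval u v w :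
  gdist u w + gdist w v = gdist u v <-> val u `&` val v `<=` val w.
Proof.
have [s us uwE] := dual_diff_enum u w.
have [t ut wvE] := dual_diff_enum w v.
have [ou ov ow] := And3 (dual_orientation u) (dual_orientation v) (dual_orientation w).
rewrite (dual_gdistE us uwE) (dual_gdistE ut wvE); split=> [d|uvw].
  move=> x [ux vx]; apply: contrapT => nwx.
  have xs : x \in s by have : (val u `\` val w) x by []; rewrite uwE.
  have : gdist u v <= size (rem x s ++ t).
    apply: dual_gdist_le; apply: size_boundedW (leqnn _) (@size_bounded_seq _ _).
    move=> y [uy nvy]; suff : y \in rem x s ++ t by [].
    rewrite mem_cat mem_rem_uniq// inE.
    have [wy|nwy] := pselect (val w y).
      have : (val w `\` val v) y by [].
      by rewrite wvE => yt; apply/orP; right.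
    have : (val u `\` val w) y by [].
    rewrite uwE => ys; apply/orP; left; apply/andP; split => //.
    by apply/eqP => yx; apply: nvy; rewrite yx.
  have : 0 < size s by case: s xs {us uwE d}.
  by rewrite size_cat size_rem// -d; case: (size s) => // k _; rewrite addSn ltnn.
rewrite -size_cat; apply/esym/dual_gdistE.
  rewrite cat_uniq us ut andbT /=; apply/hasPn => x xt; apply/negP => xs.
  have : [set` t] x by []; rewrite -wvE => -[wx _].
  by have : [set` s] x by []; rewrite -uwE => -[_].
rewrite predeqE => x; split=> [[ux nvx]|].
  suff : x \in s ++ t by []; rewrite mem_cat; apply/orP.
  have [wx|nwx] := pselect (val w x); [right | left].
    by have : (val w `\` val v) x by []; rewrite wvE.
  by have : (val u `\` val w) x by []; rewrite uwE.
move=> xst; have {xst} : x \in s ++ t by [].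
rewrite mem_cat => /orP[xs|xt].
  have : [set` s] x by []; rewrite -uwE => -[ux nwx]; split => // vx.
  exact/nwx/uvw.
have : [set` t] x by []; rewrite -wvE => -[wx nvx]; split => //.
apply: contrapT => nux; have nx : val w (pneg x).
  by apply: uvw; split; [apply/(ou.2 x) | apply/(ov.2 x)].
exact: ((ow.2 x).1 nx).
Qed.

Definition majority (u v w : set P) : set P :=
  (u `&` v) `|` (v `&` w) `|` (w `&` u).

Lemma majority_orientation (u v w : set P) :
  orientation u -> orientation v -> orientation w ->
  orientation (majority u v w).
Proof.
move=> [uup uN] [vup vN] [wup wN]; split=> [s t [[[h1 h2]|[h1 h2]]|[h1 h2]] st|s].
- by left; left; split; [apply: uup st | apply: vup st].
- by left; right; split; [apply: vup st | apply: wup st].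
- by right; split; [apply: wup st | apply: uup st].
- rewrite /majority /setU /setI /=; rewrite uN vN wN.
  by case: (pselect (u s)) (pselect (v s)) (pselect (w s)) => ? [] ? [] ?; tauto.
Qed.

(** The majority vote is the median. By [dual_interval], a vertex in all three intervals contains
    the majority, and an orientation contained in another one equals it. *)
Lemma dual_median_graph : median_graph dual_graph.
Proof.
split=> [|u v w]; first exact: dual_connected.
have [ou ov ow] := And3 (dual_orientation u) (dual_orientation v) (dual_orientation w).
have om := majority_orientation ou ov ow.
have /asboolP[_ [b Bb ub]] := valP u.
have [|m mE] := dual_vertex_intro om Bb.
  apply: (@sub_finite_set _ _ ((val u `\` b) `|` (val v `\` val u))).
    move=> x [[[[]|[vx wx]]|[]] nbx]; try by left.
    have [ux|nux] := pselect (val u x); [by left | by right].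
  by rewrite finite_setU; split => //; apply: dual_diff_finite.
exists m; rewrite eqEsubset; split=> [x|_ ->].
  move=> [[/(geod_intervalE dual_connected)/dual_interval ux
    /(geod_intervalE dual_connected)/dual_interval vx]
    /(geod_intervalE dual_connected)/dual_interval wx].
  apply/esym/dual_diff0; rewrite mE -subset0 => s [ms nxs]; apply: nxs.
  by case: ms => [[/ux|/vx]|/wx].
by split; [split|]; apply/(geod_intervalE dual_connected)/dual_interval;
  rewrite mE => s ?; [left; left | left; right | right].
Qed.

(** If [w] contains [s], then [u] contains all that [w] and [v] share, hence lies between them and
    is nearer to [w]. *)
Lemma dual_side u v s : val u `\` val v = [set s] ->
  side u v = [set w : dual_graph | val w s].
Proof.
have lt (a b : dual_graph) t (w : dual_graph) : val a `\` val b = [set t] -> val w t ->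
    gdist w a < gdist w b.
  move=> abE wt.
  have [oa ob ow] := And3 (dual_orientation a) (dual_orientation b) (dual_orientation w).
  have /dual_interval <- : val w `&` val b `<=` val a.
    move=> r [wr br]; apply: contrapT => nar.
    have : (val a `\` val b) (pneg r).
      by apply/(orientation_nd r ob oa).1.
    rewrite abE /= => e; move: wt; rewrite -e.
    by move=> /(ow.2 r).
  have : gdist a b = 1.
    apply: gdist_adj; first exact: dual_connected.
    by apply/asboolP; exists t.
  by lia.
move=> uvE; rewrite predeqE => w; split=> [/= wu|ws]; last exact: lt uvE ws.
apply: contrapT => /= nws; suff : gdist w v < gdist w u by rewrite /side /= in wu; lia.
have [ou ov ow] := And3 (dual_orientation u) (dual_orientation v) (dual_orientation w).
apply: (lt _ _ (pneg s)); last exact/(ow.2 s).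
have /asboolP[t vuE] : adj v u by rewrite adj_sym; apply/asboolP; exists s.
have : (val v `\` val u) (pneg s).
  by apply/(orientation_nd s ou ov).1; rewrite uvE.
by rewrite vuE => <-.
Qed.

Lemma dual_theta_class (h : set (dual_graph * dual_graph)) : theta_classes h ->
  exists s, plus_side h = [set w : dual_graph | val w s] /\
            minus_side h = [set w : dual_graph | val w (pneg s)].
Proof.
move=> /(theta_classP dual_median_graph)[a [b [/asboolP[s abE] _ -> ->]]].
exists s; rewrite (dual_side abE); split => //.
rewrite predeqE => w; split=> [nws|]; first exact/((dual_orientation w).2 s).
by move=> /((dual_orientation w).2 s).
Qed.

(** Each of the four non-empty corners is an orientation that rules out one of the four ways to be
    nested. *)
Lemma dual_crossing_bounded :
  crossing_bounded (@pcross P) setT -> graph_crossing_bounded dual_graph.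
Proof.
pose r (h : set (dual_graph * dual_graph)) s :=
  [/\ theta_classes h, plus_side h = [set w : dual_graph | val w s] &
      minus_side h = [set w : dual_graph | val w (pneg s)]].
apply: (crossing_bounded_transfer (r := r)) => [h hP|h k s _ _ [hP e _] [kP e' _] _|].
- by have [s [e1 e2]] := dual_theta_class hP; exists s.
- by apply: (plus_side_inj dual_median_graph) => //; rewrite e e'.
- move=> h k s t [_ hp hm] [_ kp km]; rewrite /theta_cross hp hm kp km.
  move=> [[w1 [a1 b1]] [w2 [a2 b2]] [w3 [a3 b3]] [w4 [a4 b4]]].
  have upN w := (dual_orientation w).
  case=> le.
  + by apply: ((upN w2).2 t).1 b2 _; apply: (upN w2).1 a2 le.
  + by apply: ((upN w3).2 s).1 a3 _; apply: (upN w3).1 b3 le.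
  + by apply: ((upN w1).2 t).1 b1; apply: (upN w1).1 a1 le.
  + by apply: ((upN w4).2 s).1 a4 _; apply: (upN w4).1 b4 le.
Qed.

End Dual.

(** * Group actions on the dual graph *)

Section DualAction.
Variables (Gamma : groupType) (P : pocset) (B : set (set P)) (gt : Gamma -> P -> P).
Hypothesis gt1 : forall s, gt 1%g s = s.
Hypothesis gtM : forall g h s, gt (g * h)%g s = gt g (gt h s).
Hypothesis gt_le : forall g s t, ple s t -> ple (gt g s) (gt g t).
Hypothesis gt_neg : forall g s, gt g (pneg s) = pneg (gt g s).
Hypothesis gt_B : forall g b, B b -> B (gt g @` b).

Lemma gtK g s : gt g^-1%g (gt g s) = s.
Proof. by rewrite -gtM mulVg gt1. Qed.

Lemma gtKV g s : gt g (gt g^-1%g s) = s.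
Proof. by rewrite -gtM mulgV gt1. Qed.

Lemma gt_imageE g (X : set P) s : (gt g @` X) s <-> X (gt g^-1%g s).
Proof.
split=> [[t Xt <-]|Xs]; first by rewrite gtK.
by exists (gt g^-1%g s) => //; rewrite gtKV.
Qed.

Lemma gt_imageD g (X Y : set P) : gt g @` (X `\` Y) = gt g @` X `\` gt g @` Y.
Proof.
rewrite predeqE => s; split=> [/gt_imageE[h1 h2]|[/gt_imageE h1 h2]].
  by split; [apply/gt_imageE | move=> /gt_imageE].
by apply/gt_imageE; split => //; move=> h; apply: h2; apply/gt_imageE.
Qed.

Lemma gt_orientation g (w : set P) : orientation w -> orientation (gt g @` w).
Proof.
move=> [wup wN]; split=> [s t /gt_imageE ws st|s].
  by apply/gt_imageE; apply: wup ws _; apply: gt_le.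
split=> [/gt_imageE|nws]; last apply/gt_imageE.
  by rewrite gt_neg => /wN nws /gt_imageE.
by rewrite gt_neg; apply/wN => ws; apply: nws; apply/gt_imageE.
Qed.

Lemma dual_act_subproof g (u : dual_graph B) :
  `[< orientation (gt g @` val u) /\
      exists2 b, B b & finite_set ((gt g @` val u) `\` b) >].
Proof.
have /asboolP[ou [b Bb ub]] := valP u.
apply/asboolP; split; first exact: gt_orientation.
exists (gt g @` b); first exact: gt_B.
by rewrite -gt_imageD; apply: finite_image.
Qed.

Definition dual_act g (u : dual_graph B) : dual_graph B :=
  exist _ (gt g @` val u) (dual_act_subproof g u).

Lemma dual_act1 u : dual_act 1%g u = u.
Proof.
apply: val_inj; rewrite /= predeqE => s.
by split=> [/gt_imageE|us]; rewrite ?invg1 ?gt1//; exists s.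
Qed.

Lemma dual_actM g h u : dual_act (g * h)%g u = dual_act g (dual_act h u).
Proof.
apply: val_inj; rewrite /= predeqE => s.
split=> [[t ut <-]|[_ [t ut <-] <-]]; last by exists t; rewrite // gtM.
by exists (gt h t); [exists t | rewrite gtM].
Qed.

Lemma dual_act_adj g u v : adj (dual_act g u) (dual_act g v) = adj u v.
Proof.
apply/asboolP/asboolP => /= -[s].
  rewrite -gt_imageD => /seteqP[h1 h2]; exists (gt g^-1%g s).
  rewrite eqEsubset; split=> [t uvt|_ ->].
    by have /= := h1 (gt g t) (ex_intro2 _ _ t uvt erefl) => <-; rewrite gtK.
  by have /gt_imageE := h2 s erefl.
by move=> e; exists (gt g s); rewrite -gt_imageD e image_set1.
Qed.

Definition dual_graph_action : graph_action Gamma (dual_graph B) :=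
  GraphAction dual_act1 dual_actM dual_act_adj.

End DualAction.

(** * The median decomposition of a separation system *)

Lemma sorted_comparable (T : eqType) (lt : rel T) (c : seq T) x y :
  transitive lt -> sorted lt c -> x \in c -> y \in c ->
  [\/ x = y, lt x y | lt y x].
Proof.
move=> lt_tr; elim: c => // z c IHc zc.
have /allP zmin := order_path_min lt_tr zc.
rewrite !inE => /predU1P[->|xc] /predU1P[->|yc].
- exact: Or31.
- by apply/Or32/zmin.
- by apply/Or33/zmin.
- exact: IHc (path_sorted zc) xc yc.
Qed.

(** The bound is named because it enters the construction of [height]. *)
Definition local_width_le (G : graph) (Sigma : set (set G * set G)) (R : nat) :
    Prop :=
  forall (x : G) (X : set (set G * set G)), X `<=` local_seps Sigma x ->
    pairwise_rel (@sep_comparable G) X \/ pairwise_rel (@sep_cross G) X ->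
    X #<= `I_R.

Section SeparationPocset.
Variables (G : graph) (Sigma : set (set G * set G)).
Hypothesis Ssys : separation_system Sigma.

Definition sep_type : Type := {s : set G * set G | `[< Sigma s >]}.

Lemma sep_typeP (s : sep_type) : Sigma (val s).
Proof. exact/asboolP/(valP s). Qed.

Lemma sep_neg_subproof (s : sep_type) : `[< Sigma (flip (val s)) >].
Proof. by apply/asboolP; have [] := Ssys (sep_typeP s). Qed.

Definition sep_neg (s : sep_type) : sep_type :=
  exist _ (flip (val s)) (sep_neg_subproof s).

Definition sep_ple (s t : sep_type) : Prop := sep_le (val s) (val t).

Lemma sep_ple_refl s : sep_ple s s. Proof. by split. Qed.

Lemma sep_ple_trans t s u : sep_ple s t -> sep_ple t u -> sep_ple s u.
Proof.
by move=> [h1 h2] [h3 h4]; split; [exact: subset_trans h3 | exact: subset_trans h2].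
Qed.

Lemma sep_ple_anti s t : sep_ple s t -> sep_ple t s -> s = t.
Proof.
move=> [h1 h2] [h3 h4]; apply: val_inj.
rewrite [LHS]surjective_pairing [RHS]surjective_pairing.
by congr pair; rewrite eqEsubset.
Qed.

Lemma sep_negK : involutive sep_neg.
Proof. by move=> s; apply: val_inj; rewrite /= /flip /= -surjective_pairing. Qed.

Lemma sep_ple_neg s t : sep_ple s t -> sep_ple (sep_neg t) (sep_neg s).
Proof. by move=> []. Qed.

Lemma sep_setU (s : sep_type) x : (val s).1 x \/ (val s).2 x.
Proof.
have [[sV _] _ _] := Ssys (sep_typeP s).
by have : ((val s).1 `|` (val s).2) x by rewrite sV.
Qed.

Lemma sep_ple_negF s : ~ sep_ple s (sep_neg s).
Proof.
move=> [/= h _]; have [_ [_ sV] _] := Ssys (sep_typeP s).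
apply: sV; rewrite predeqE => x; split=> // _.
by case: (sep_setU s x) => // /h.
Qed.

Definition sep_pocset : pocset := Pocset sep_ple_refl sep_ple_trans sep_ple_anti
  sep_negK sep_ple_neg sep_ple_negF.

Lemma sep_pcrossE (s t : sep_pocset) : pcross s t -> sep_cross (val s) (val t).
Proof.
move=> cr [[st|ts]|[st|ts]]; apply: cr;
  [exact: Or41 | exact: Or42 | exact: Or43 | exact: Or44].
Qed.

Lemma sep_pocset_crossing_bounded :
  sep_crossing_bounded Sigma -> crossing_bounded (@pcross sep_pocset) setT.
Proof.
apply: (crossing_bounded_transfer (r := fun (s : sep_pocset) t => val s = t)).
- by move=> s _; exists (val s) => //; apply: sep_typeP.
- by move=> s t u _ _ <- /val_inj.
- by move=> s t _ _ <- <-; apply: sep_pcrossE.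
Qed.

(** The choices imposed by [x]; only the separations with [x] on both sides stay free in its
    fibre. *)
Definition forced (x : G) : set sep_pocset :=
  [set s | ((val s).1 `\` (val s).2) x].

Definition fibre_orientations (x : G) : set (set sep_pocset) :=
  [set w | orientation w /\ forced x `<=` w].

Lemma forced_up x : up_closed (forced x).
Proof. by move=> s t [sx nsx] [st ts]; split; [exact: st | move=> /ts]. Qed.

Lemma forced_neg x s : forced x (pneg s) <-> ((val s).2 `\` (val s).1) x.
Proof. by []. Qed.

Lemma fibre_orientationsE x w : orientation w ->
  fibre_orientations x w <-> forall s, w s -> (val s).1 x.
Proof.
move=> ow; split=> [[_ xw] s ws|wx]; last first.
  split=> // s [sx nsx]; apply: contrapT => /(ow.2 s) /wx.
  exact: nsx.
apply: contrapT => nsx; case: (sep_setU s x) => // sx.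
have /xw : forced x (pneg s) by [].
by move=> /(ow.2 s).
Qed.

(** A conflict between the choices imposed by [x] and by [y] would be a separation with an edge
    between its two strict sides. *)
Lemma adj_fibre_orientations x y : adj x y ->
  fibre_orientations x `&` fibre_orientations y !=set0.
Proof.
move=> xy; have [||w ow xyw] := @orientation_extend _ (forced x `|` forced y).
- by move=> s t [sx|sy] st; [left | right]; apply: forced_up st.
- move=> s; have [[_ sep] _ _] := Ssys (sep_typeP s).
  move=> [[h1 h2]|[h1 h2]] [/forced_neg[h3 h4]|/forced_neg[h3 h4]] //.
    by have := sep x y (conj h1 h2) (conj h3 h4); rewrite xy.
  by have := sep y x (conj h1 h2) (conj h3 h4); rewrite adj_sym xy.
- by exists w; split; split=> // s ?; apply: xyw; [left | right].
Qed.

(** An imposed choice conflicting with [s] would lie below [pneg s], so [pneg s] would be imposed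
    too and [x] could not lie on the first side of [s]. *)
Lemma fibre_orientations_through x (s : sep_pocset) : (val s).1 x ->
  exists2 w, fibre_orientations x w & w s.
Proof.
move=> sx; have [||w ow xyw] := @orientation_extend _ (forced x `|` [set t | ple s t]).
- move=> t u [tx|st] tu; [left | right]; first exact: forced_up tu.
  exact: ple_trans tu.
- have nforced t : forced x t -> ~ ple s (pneg t).
    move=> tx st; have /forced_neg[] : forced x (pneg s); last by [].
    by apply: forced_up tx _; rewrite -(pnegK t); apply: ple_neg.
  move=> t [tx|st] [tnx|snt].
  + by case: tx tnx => [? ?] /forced_neg[].
  + exact: nforced snt.
  + by apply: nforced tnx _; rewrite pnegK.
  + apply: (@ple_negF _ s); apply: ple_trans st _.
    by rewrite -(pnegK t); apply: ple_neg.
- exists w; first by split=> // t tx; apply: xyw; left.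
  by apply: xyw; right; exact: ple_refl.
Qed.

Lemma fibre_orientations_ex x : exists w, fibre_orientations x w.
Proof.
have [||w ow xw] := @orientation_extend _ (forced x).
- exact: forced_up.
- by move=> s [? ?] /forced_neg[].
- by exists w.
Qed.

Section LocalWidth.
Variable R : nat.
Hypothesis SR : local_width_le Sigma R.

Lemma local_seq_bounded x (c : seq sep_pocset) : uniq c ->
  {in c, forall s, ((val s).1 `&` (val s).2) x} ->
  {in c &, forall s t, s <> t -> ple s t \/ ple t s} \/
    {in c &, forall s t, s <> t -> pcross s t} -> size c <= R.
Proof.
move=> uc cx cc; rewrite -(size_map val).
have uv : uniq (map val c) by rewrite map_inj_uniq //; apply: val_inj.
apply: ((card_le_size_bounded [set` map val c] R).1 _ _ uv) => //.
apply: (@SR x).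
  by move=> _ /mapP[s sc ->]; split; [exact: sep_typeP | exact: cx].
case: cc => cc; [left | right] => _ _ /mapP[s sc ->] /mapP[t tc ->] st.
  by apply: cc => // e; apply: st; rewrite e.
by apply: sep_pcrossE; apply: cc => // e; apply: st; rewrite e.
Qed.

Definition sep_plt : rel sep_pocset := fun s t => `[< ple s t /\ s <> t >].

Lemma sep_plt_trans : transitive sep_plt.
Proof.
move=> t s u /asboolP[st nst] /asboolP[tu ntu]; apply/asboolP.
split; first exact: ple_trans tu.
by move=> su; apply: nst; apply: ple_anti => //; rewrite su.
Qed.

Lemma sep_plt_irr : irreflexive sep_plt.
Proof. by move=> s; apply/asboolP => -[]. Qed.

Lemma local_chain_bounded x (c : seq sep_pocset) : sorted sep_plt c ->
  {in c, forall s, ((val s).1 `&` (val s).2) x} -> size c <= R.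
Proof.
move=> cs cx; apply: (local_seq_bounded (x := x)) => //.
  exact: (sorted_uniq sep_plt_trans sep_plt_irr).
left=> s t sc tc st.
case: (sorted_comparable sep_plt_trans cs sc tc) => [//||] /asboolP[? _].
  by left.
by right.
Qed.

Lemma local_seps_bounded x (X : set sep_pocset) :
    (forall s, X s -> ((val s).1 `&` (val s).2) x) ->
    (forall s t, X s -> X t -> [\/ pcross s t, ple s t | ple t s]) ->
  size_bounded X (R * R).
Proof.
move=> Xx Xc; apply: (@size_bounded_chain_antichain _ sep_plt).
- exact: sep_plt_trans.
- exact: sep_plt_irr.
- by move=> c cs cX; apply: (local_chain_bounded (x := x)) => // s /cX /Xx.
- move=> c uc cX clt; apply: (local_seq_bounded (x := x)) => //.
    by move=> s /cX /Xx.
  right=> s t sc tc st; case: (Xc s t (cX _ sc) (cX _ tc)) => // le.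
    by have /asboolP[] := clt s t sc tc.
  by have /asboolP[] := clt t s tc sc; split=> // /esym.
Qed.

(** Where [w] and [w'] differ, [x] lies on both sides. By local width, chains and antichains among
    these separations have at most [R] members, so Mirsky's theorem applies. *)
Lemma fibre_orientations_bounded x w w' : fibre_orientations x w ->
  fibre_orientations x w' -> size_bounded (w `\` w') (R * R).
Proof.
move=> xw xw'; have [[ow _] [ow' _]] := (xw, xw').
apply: (local_seps_bounded (x := x)) => [s [ws nws]|s t]; last first.
  exact: orientation_diff_nested.
split; first exact: ((fibre_orientationsE x ow).1 xw s ws).
by have := (fibre_orientationsE x ow').1 xw' (pneg s) ((ow'.2 s).2 nws).
Qed.

Hypothesis G_conn : connected_graph G.

Definition fibres : set (set sep_pocset) := \bigcup_x fibre_orientations x.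

Lemma fibres_orientation w : fibres w -> orientation w.
Proof. by move=> [x _ []]. Qed.

(** Along a walk in [G] consecutive fibres share an orientation, and two orientations in one fibre
    differ finitely. *)
Lemma fibres_finite w w' : fibres w -> fibres w' -> finite_set (w `\` w').
Proof.
move=> [x _ xw] [y _ yw']; have [p] := G_conn x y.
elim: p x w xw => [|z p IHp] x w xw; rewrite /walk /=.
  move=> /eqP xy; apply/finite_size_bounded; exists (R * R).
  by apply: (@fibre_orientations_bounded y) => //; rewrite -xy.
move=> /andP[/andP[xz zp] lp]; have [w0 [xw0 zw0]] := adj_fibre_orientations xz.
apply: (setD_finite_trans (v := w0)); last by apply: IHp zw0 _; rewrite /walk zp lp.
apply/finite_size_bounded; exists (R * R).
exact: (@fibre_orientations_bounded x).
Qed.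

Definition fibre_graph : graph := dual_graph fibres.

Let medM := dual_median_graph fibres_orientation fibres_finite.
Let M_conn := dual_connected fibres_orientation fibres_finite.

Definition bag (u : fibre_graph) : set G :=
  [set x | forall s, val u s -> (val s).1 x].

Lemma bagE u x : bag u x <-> fibre_orientations x (val u).
Proof. by rewrite fibre_orientationsE//; exact: dual_orientation. Qed.

Lemma fibre_vertex x w : fibre_orientations x w ->
  exists2 u : fibre_graph, val u = w & bag u x.
Proof.
move=> xw; have [ow _] := xw.
have [||u uw] := @dual_vertex_intro _ fibres w w ow.
- by exists x.
- by rewrite setDv; exact: finite_set0.
- by exists u => //; rewrite bagE uw.
Qed.

Lemma bag_decomposition : median_decomposition bag.
Proof.
split=> [||x y xy|x u v p xu xv gp w wp] //.
- rewrite predeqE => x; split=> // _; have [w xw] := fibre_orientations_ex x.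
  by have [u _ xu] := fibre_vertex xw; exists u.
- have [w [xw yw]] := adj_fibre_orientations xy.
  by have [u uw xu] := fibre_vertex xw; exists u; split=> //; apply/bagE; rewrite uw.
(* Convexity: a vertex between [u] and [v] contains their common elements, among them all of
   [forced x]. *)
- have /dual_interval := geodesic_split M_conn gp wp.
  move=> /(_ fibres_orientation fibres_finite) uvw.
  apply/bagE; split; first exact: dual_orientation.
  have [/bagE[_ xu'] /bagE[_ xv']] := (xu, xv).
  by move=> s sx; apply: uvw; split; [exact: xu' | exact: xv'].
Qed.

(** The class that flips [s] gives back [s]: each vertex on a side of [s] has an orientation in its
    fibre choosing that side. Thus the decomposition is reduced. *)
Lemma bag_theta_separation h : theta_classes h ->
  exists s : sep_pocset, [/\ theta_separation bag h = val s &
    plus_side h = [set u : fibre_graph | val u s]].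
Proof.
move=> hM.
have [s [hp hm]] := dual_theta_class fibres_orientation fibres_finite hM.
exists s; split=> //.
have side_bags (t : sep_pocset) :
    \bigcup_(u in [set u : fibre_graph | val u t]) bag u = (val t).1.
  rewrite predeqE => x; split=> [[u ut]|tx]; first by apply.
  have [w xw wt] := fibre_orientations_through tx.
  by have [u uw xu] := fibre_vertex xw; exists u => //=; rewrite uw.
rewrite /theta_separation hp hm (side_bags s) (side_bags (pneg s)) /=.
by rewrite -surjective_pairing.
Qed.

Lemma bag_reduced : reduced_decomposition bag.
Proof.
split=> [h hM|h k].
  have [s [-> _]] := bag_theta_separation hM.
  by have [] := Ssys (sep_typeP s).
rewrite !inE => hM kM; have [s [-> hs]] := bag_theta_separation hM.
have [t [-> kt]] := bag_theta_separation kM.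
move=> /val_inj st; apply: (plus_side_inj medM) => //.
by rewrite hs kt st.
Qed.

Lemma bag_bounded : bounded_fibres bag.
Proof.
exists (R * R) => x u v /bagE xu /bagE xv.
apply: (dual_gdist_le fibres_orientation fibres_finite).
exact: (@fibre_orientations_bounded x).
Qed.

(** Fibres of [x] and [y] that both come within [r] of [v] contain orientations at distance at most
    [r + r]. These differ on every separation of [x] from [y], which bounds the number of such
    separations and hence the distance of [x] and [y]. *)
Lemma bag_properly_supported :
  increasing_separations Sigma -> properly_supported bag.
Proof.
move=> [N /nat_cvg_infty N_oo NP] r.
have [m mP] := N_oo (r + r).+1; exists m => v x y [u xu vu] [u' yu' vu'].
rewrite leqNgt; apply/negP => mxy.
have := NP _ x y (leqnn _) => /card_ge_seq[s [us sS]].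
have := mP _ (ltnW mxy) => h1 h2.
have : size_bounded [set s | [/\ Sigma s, (s.1 `\` s.2) x & (s.2 `\` s.1) y]] (r + r).
  have d : gdist u u' <= r + r.
    apply: leq_trans (gdist_triangle M_conn v u u') _.
    by rewrite (gdistC M_conn u) leq_add.
  have := @dual_gdist_bounded _ _ fibres_orientation fibres_finite u u'.
  move=> /(size_boundedW (@subset_refl _ _) d).
  apply: (size_bounded_inj (r := fun t s => val s = t)).
    move=> t [tS tx ty]; have tT : `[< Sigma t >] by apply/asboolP.
    exists (exist _ t tT) => //; split.
      by have /bagE[_] := xu; apply.
    have /bagE[ou' yu] := yu'; apply/(ou'.2 (exist _ t tT : sep_pocset)).
    exact: yu.
  by move=> t t' q _ _ <- <-.
move=> /(_ s us sS); lia.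
Qed.

Section Action.
Variables (Gamma : groupType) (aG : graph_action Gamma G).
Hypothesis Sinv : sep_invariant aG Sigma.

Lemma sep_act_subproof g (s : sep_pocset) :
  `[< Sigma (aG g @` (val s).1, aG g @` (val s).2) >].
Proof. exact/asboolP/Sinv/sep_typeP. Qed.

Definition sep_act g (s : sep_pocset) : sep_pocset :=
  exist _ (aG g @` (val s).1, aG g @` (val s).2) (sep_act_subproof g s).

Lemma sep_act1 s : sep_act 1%g s = s.
Proof.
apply: val_inj; rewrite /= [RHS]surjective_pairing; congr pair;
  by rewrite predeqE => x; rewrite act_imageE invg1 act1.
Qed.

Lemma sep_actM g h s : sep_act (g * h)%g s = sep_act g (sep_act h s).
Proof.
apply: val_inj => /=; congr pair;
  by rewrite predeqE => x; rewrite !act_imageE invgM actM.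
Qed.

Lemma sep_act_le g (s t : sep_pocset) : ple s t -> ple (sep_act g s) (sep_act g t).
Proof. by move=> [st ts]; split; apply: image_subset. Qed.

Lemma sep_act_neg g (s : sep_pocset) : sep_act g (pneg s) = pneg (sep_act g s).
Proof. exact: val_inj. Qed.

Lemma sep_act_fst g s x : (val (sep_act g s)).1 (aG g x) <-> (val s).1 x.
Proof.
by split=> [/act_imageE|sx]; [|apply/act_imageE]; rewrite -actM mulVg act1.
Qed.

Lemma sep_act_snd g s x : (val (sep_act g s)).2 (aG g x) <-> (val s).2 x.
Proof.
by split=> [/act_imageE|sx]; [|apply/act_imageE]; rewrite -actM mulVg act1.
Qed.

Lemma fibre_orientations_act g x w : fibre_orientations x w ->
  fibre_orientations (aG g x) (sep_act g @` w).
Proof.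
move=> xw; have [ow _] := xw.
have ogw := gt_orientation sep_act1 sep_actM sep_act_le sep_act_neg g ow.
apply/(fibre_orientationsE _ ogw) => _ [s ws <-]; apply/sep_act_fst.
exact: ((fibre_orientationsE x ow).1 xw).
Qed.

Lemma fibres_act g w : fibres w -> fibres (sep_act g @` w).
Proof.
by move=> [x _ xw]; exists (aG g x) => //; apply: fibre_orientations_act.
Qed.

Definition fibre_action : graph_action Gamma fibre_graph :=
  dual_graph_action sep_act1 sep_actM sep_act_le sep_act_neg fibres_act.

Lemma bag_canonical : canonical_decomposition bag aG fibre_action.
Proof.
move=> g u; have sub h v : aG h @` bag v `<=` bag (fibre_action h v).
  by move=> _ [x /bagE xv <-]; apply/bagE; apply: fibre_orientations_act.
rewrite eqEsubset; split=> [|x xu]; first exact: sub.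
apply/act_imageE.
have := sub g^-1%g (fibre_action g u) (aG g^-1%g x).
by rewrite -actM mulVg act1; apply; exists x.
Qed.

End Action.

End LocalWidth.

End SeparationPocset.

(** * Canonical centres of the fibres *)

Section Double.
Variable P : pocset.
Implicit Types d e f : P * bool.

(* Lexicographic: [(s, false)] means lying on the side [s] and [(s, true)] not
   lying on the side [pneg s], so that a pair of undecided elements [s], [pneg s]
   becomes an orientation. *)
Definition double_le d e : Prop :=
  (d.1 = e.1 /\ (d.2 ==> e.2)) \/ (d.1 <> e.1 /\ ple d.1 e.1).

Definition double_neg d : P * bool := (pneg d.1, ~~ d.2).

Lemma double_le1 d e : double_le d e -> ple d.1 e.1.
Proof. by case=> [[-> _]|[]//]; exact: ple_refl. Qed.

Lemma double_le_refl d : double_le d d.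
Proof. by left; rewrite implybb. Qed.

Lemma double_le_trans e d f : double_le d e -> double_le e f -> double_le d f.
Proof.
move=> de ef; have df := ple_trans (double_le1 de) (double_le1 ef).
have [dfE|] := pselect (d.1 = f.1); last by right.
have deE : d.1 = e.1.
  by apply: ple_anti (double_le1 de) _; rewrite dfE; apply: double_le1.
left; split => //; case: de => [[_ de]|[]//]; case: ef => [[_ ef]|[]]; last first.
  by rewrite -deE dfE.
by move: de ef; case: d.2 e.2 f.2 => [] [] [].
Qed.

Lemma double_le_anti d e : double_le d e -> double_le e d -> d = e.
Proof.
move=> de ed; have deE := ple_anti (double_le1 de) (double_le1 ed).
case: de => [[_ de]|[]//]; case: ed => [[_ ed]|[]]; last by rewrite deE.
rewrite [LHS]surjective_pairing [RHS]surjective_pairing deE; congr pair.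
by move: de ed; case: d.2 e.2 => [] [].
Qed.

Lemma double_negK : involutive double_neg.
Proof. by move=> [s b]; rewrite /double_neg /= pnegK negbK. Qed.

Lemma double_le_neg d e : double_le d e -> double_le (double_neg e) (double_neg d).
Proof.
case=> [[de h]|[de h]]; [left | right]; rewrite /=.
  by split; [rewrite de | rewrite implybNN].
split; last exact: ple_neg.
by move=> /(can_inj (@pnegK P)) /esym.
Qed.

Lemma double_le_negF d : ~ double_le d (double_neg d).
Proof. by move=> /double_le1 /ple_negF. Qed.

Definition double : pocset := Pocset double_le_refl double_le_trans
  double_le_anti double_negK double_le_neg double_le_negF.

(** Copies of comparable elements are comparable, including the two copies of one element. *)
Lemma double_cross (d e : double) : pcross d e -> pcross d.1 e.1.
Proof.
have cmp f g : ple f.1 g.1 -> double_le f g \/ double_le g f.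
  move=> fg; have [fgE|] := pselect (f.1 = g.1); last by left; right.
  case fb : f.2; last by left; left; rewrite fb.
  by right; left; rewrite fgE fb implybT.
move=> cr [/cmp[]|/cmp[]|h|h] => [?|?|?|?||]; apply: cr.
- exact: Or41.
- exact: Or42.
- exact: Or42.
- exact: Or41.
- by case: (cmp d (double_neg e) h) => ?; [exact: Or43 | exact: Or44].
- by case: (cmp (double_neg e) d h) => ?; [exact: Or44 | exact: Or43].
Qed.

Lemma double_crossing_bounded :
  crossing_bounded (@pcross P) setT -> crossing_bounded (@pcross double) setT.
Proof.
apply: (crossing_bounded_transfer (r := fun (d : double) s => d.1 = s)).
- by move=> d _; exists d.1.
- move=> d e s _ _ <- de /double_cross; rewrite de => cr.
  by case: cr; apply/Or41/ple_refl.
- by move=> d e s t <- <-; apply: double_cross.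
Qed.

End Double.

(** * Heights, centres and the embedding they define *)

Section CanonicalOrientation.
Variables (G : graph) (Sigma : set (set G * set G)).
Hypothesis Ssys : separation_system Sigma.
Variable R : nat.
Hypothesis SR : local_width_le Sigma R.
Notation P := (sep_pocset Ssys).
Implicit Types s t : P.

Definition cuts (x : G) s : Prop := ((val s).1 `&` (val s).2) x.

Definition chain_below (x : G) s (c : seq P) : Prop :=
  sorted (@sep_plt _ _ Ssys) c /\ {in c, forall t, cuts x t /\ ple t s}.

(** The greatest length of a chain of separations cutting [x] and lying below [s], with [s] itself
    allowed. The range of [k] loses nothing, since chains at [x] have length at most [R]. *)
Definition height (x : G) s : nat :=
  \max_(k < R.+1 | `[< exists2 c, chain_below x s c & size c = k >]) k.

Lemma height_ge x s c : chain_below x s c -> size c <= height x s.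
Proof.
move=> cs; have cR : size c < R.+1.
  rewrite ltnS; apply: (local_chain_bounded SR (x := x) cs.1).
  by move=> t /cs.2[].
apply: (@leq_bigmax_cond _ _ (fun k : 'I_R.+1 => val k) (Ordinal cR)).
by apply/asboolP; exists c.
Qed.

Lemma height_ex x s : exists2 c, chain_below x s c & size c = height x s.
Proof.
rewrite /height.
have [|k] := @eq_bigmax_cond _
    [pred k : 'I_R.+1 | `[< exists2 c, chain_below x s c & size c = k >]] val.
  by apply/card_gt0P; exists ord0; apply/asboolP; exists [::].
by move=> /asboolP + ->.
Qed.

Lemma height_le x s t : ple s t -> height x s <= height x t.
Proof.
move=> st; have [c [cs cx] <-] := height_ex x s.
apply: height_ge; split=> // r /cx[rx rs]; split=> //; exact: ple_trans st.
Qed.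

Lemma height_lt x s t : ple s t -> s <> t -> cuts x t ->
  height x s < height x t.
Proof.
move=> st nst tx; have [c [cs cx] <-] := height_ex x s.
rewrite -(size_rcons c t); apply: height_ge; split.
  move: cs; rewrite !(sorted_pairwise (@sep_plt_trans _ _ Ssys)) pairwise_rcons => ->.
  rewrite andbT; apply/allP => r /cx[rx rs]; apply/asboolP; split.
    exact: ple_trans st.
  by move=> rt; apply: nst; apply: ple_anti => //; rewrite -rt.
move=> r; rewrite mem_rcons inE => /predU1P[->|/cx[rx rs]].
  by split=> //; exact: ple_refl.
by split=> //; exact: ple_trans st.
Qed.

(* The centre of the fibre of [x]: a separation cutting [x] is oriented towards
   the side with the longer chains below it, and left open in case of a tie;
   the open ones then pairwise cross. *)
Definition center (x : G) : set P :=
  [set s | forced x s \/ cuts x s /\ height x (pneg s) < height x s].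

Lemma cuts_neg x s : cuts x s <-> cuts x (pneg s).
Proof. by split=> -[]. Qed.

Lemma center_up x : up_closed (center x).
Proof.
move=> s t [sx|[[sx1 sx2] hs]] st; first by left; apply: forced_up sx st.
have tx : (val t).1 x by apply: st.1.
have [tx2|ntx2] := pselect ((val t).2 x); last by left.
right; split=> //; apply: leq_trans (height_le x st).
by apply: leq_ltn_trans hs; apply/height_le/ple_neg.
Qed.

Lemma center_neg x s : center x s -> ~ center x (pneg s).
Proof.
move=> [[s1 s2]|[[s1 s2] hs]] [[s3 s4]|[[s3 s4] hs']] //.
by move: hs'; rewrite (pnegK s) ltnNge ltnW.
Qed.

(** At a tie, passing strictly above [s] raises the height if [t] cuts [x], while the height of the
    complement does not grow, so the tie is broken in favour of [t]. This makes the lexicographic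
    orientation up-closed. *)
Lemma center_above x s t : ~ center x (pneg s) -> ple s t -> s <> t -> center x t.
Proof.
move=> nxs st nst; have [xs|xs] := pselect (center x s); first exact: center_up xs st.
have sx : cuts x s.
  case: (sep_setU Ssys s x) => sx; split=> //; apply: contrapT => nsx.
    by apply: xs; left.
  by apply: nxs; left.
have hs : height x s = height x (pneg s).
  case: (ltngtP (height x s) (height x (pneg s))) => // h.
    by case: nxs; right; split; [apply/cuts_neg; rewrite pnegK | rewrite pnegK].
  by case: xs; right.
have tx : (val t).1 x by apply: st.1; case: sx.
have [tx2|ntx2] := pselect ((val t).2 x); last by left.
right; split=> //; apply: leq_ltn_trans (height_lt st nst _) => //.
by rewrite hs; apply/height_le/ple_neg.
Qed.

(** An undecided pair contributes the copies marked [true] of both its members, which encodes the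
    barycentre of the cube. *)
Definition center_orientation (x : G) : set (double P) :=
  [set d | if d.2 then ~ center x (pneg d.1) else center x d.1].

Lemma center_orientation_or x : orientation (center_orientation x).
Proof.
split=> [[s b] [t c]|[s b]]; last first.
  case: b; first by split=> [sx nsx|]; [exact: nsx sx | exact: contrapT].
  have -> : center_orientation x (@pneg (double P) (s, false)) =
    (~ center x (pneg (pneg s))) by [].
  by rewrite pnegK.
rewrite /center_orientation /= => sb.
have ns : ~ center x (pneg s).
  by move: sb; case: b => //= /center_neg.
case=> /= [[<- ]|[st le_st]].
  by move: sb; case: b c => [] [].
have tx := center_above ns le_st st.
by case: c => //; apply: center_neg.
Qed.

(** A separation cutting neither end of an edge has both ends strictly on the same side, so both
    centres decide it alike. *)
Lemma center_orientation_agree x y d : adj x y ->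
    (center_orientation x `\` center_orientation y) d ->
  cuts x d.1 \/ cuts y d.1.
Proof.
case: d => s b xy [xs nys]; rewrite /cuts /=.
have [[_ sep] _ _] := Ssys (sep_typeP s).
have [h|nx] := pselect (cuts x s); first by left.
have [h|ny] := pselect (cuts y s); first by right.
exfalso; have off z : ~ cuts z s -> forced z s \/ forced z (pneg s).
  move=> nz; case: (sep_setU Ssys s z) => sz; [left | right]; split=> // sz';
    by apply: nz.
case: (off x nx) (off y ny) => [fx|fx] [fy|fy].
- apply: nys; rewrite /center_orientation /=.
  have ys : center y s by left.
  by case: b {xs}; first exact: center_neg.
- by have := sep x y fx fy; rewrite xy.
- by have := sep y x fy fx; rewrite adj_sym xy.
- have xs' : center x (pneg s) by left.
  move: xs; rewrite /center_orientation /=; case: b {nys} => //.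
  by move=> /center_neg.
Qed.

(** Four families, according to which of [x] and [y] is cut and which copy is involved, each with at
    most [R * R] members by Mirsky's theorem. *)
Lemma center_orientation_adj_bounded x y : adj x y ->
  size_bounded (center_orientation x `\` center_orientation y)
    ((R * R + R * R) + (R * R + R * R)).
Proof.
move=> xy; set X := _ `\` _.
have part z b : size_bounded (X `&` [set d | d.2 = b /\ cuts z d.1]) (R * R).
  apply: (size_bounded_inj (r := fun (d : double P) s => d.1 = s)
    (Y := [set s : P | cuts z s /\ X (s, b)])).
  - move=> [s b'] [Xs [/= <- zs]]; by exists s.
  - move=> [s b1] [t b2] u [_ [/= -> _]] [_ [/= -> _]] /= -> ->; by [].
  - apply: (local_seps_bounded SR (x := z)) => [s []//|s t [_ Xs] [_ Xt]].
    case: (orientation_diff_nested (center_orientation_or x)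
      (center_orientation_or y) Xs Xt) => [/double_cross ?|/double_le1 ?|/double_le1 ?].
    + exact: Or31.
    + exact: Or32.
    + exact: Or33.
apply: size_boundedW (leqnn _) (size_boundedU
  (size_boundedU (part x true) (part x false))
  (size_boundedU (part y true) (part y false))).
move=> [s b] Xs; have := center_orientation_agree xy Xs.
by case: b Xs => Xs [] ?; [left; left | right; left | left; right | right; right].
Qed.

Hypothesis G_conn : connected_graph G.

Let base := range center_orientation.

Lemma center_base_orientation w : base w -> orientation w.
Proof. by move=> [x _ <-]; apply: center_orientation_or. Qed.

Lemma center_base_finite w w' : base w -> base w' -> finite_set (w `\` w').
Proof.
move=> [x _ <-] [y _ <-]; have [p] := G_conn x y.
elim: p x => [|z p IHp] x; rewrite /walk /=.
  by move=> /eqP ->; rewrite setDv; apply: finite_set0.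
move=> /andP[/andP[xz zp] lp].
apply: (setD_finite_trans (v := center_orientation z)).
  by apply/finite_size_bounded; eexists; apply: center_orientation_adj_bounded.
by apply: IHp; rewrite /walk zp lp.
Qed.

Definition center_graph : graph := dual_graph base.

Lemma center_vertex_subproof x : `[< orientation (center_orientation x) /\
  exists2 b, base b & finite_set (center_orientation x `\` b) >].
Proof.
apply/asboolP; split; first exact: center_orientation_or.
by exists (center_orientation x); [exists x | rewrite setDv; apply: finite_set0].
Qed.

Definition center_vertex x : center_graph :=
  exist _ (center_orientation x) (center_vertex_subproof x).

Lemma center_graph_median : median_graph center_graph.
Proof. exact: dual_median_graph center_base_orientation center_base_finite. Qed.

Lemma center_coarse :
  increasing_separations Sigma -> coarse_embedding center_vertex.
Proof.
move=> [N /nat_cvg_infty N_oo NP].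
have M_conn := dual_connected center_base_orientation center_base_finite.
set K := (R * R + R * R) + (R * R + R * R).
(* [K] bounds the displacement along one edge, and the successor makes the constant positive. The
   running maximum turns [N] into a non-decreasing function. *)
exists K.+1, (fun n => \max_(k < n.+1) N k); split=> //.
- move=> m n mn; apply/bigmax_leqP => k _.
  by apply: (leq_bigmax_cond (Ordinal (leq_trans (ltn_ord k) (mn : m < n.+1)))).
- apply/nat_cvg_infty => k; have [m mP] := N_oo k; exists m => n mn.
  apply: leq_trans (mP n mn) _.
  exact: (@leq_bigmax_cond _ xpredT (fun k : 'I_n.+1 => N k) ord_max).
move=> x y; apply/andP; split.
  apply/bigmax_leqP => k _; have kxy : k <= gdist x y by rewrite -ltnS.
  have /card_ge_seq[s [us sS Ns]] := NP k x y kxy.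
  apply: leq_trans Ns _.
  have := @dual_gdist_bounded _ _ center_base_orientation center_base_finite
    (center_vertex x) (center_vertex y).
  move=> b; move: s us sS; move: b; apply: (size_bounded_inj
    (r := fun q (d : double P) => val d.1 = q /\ d.2 = false)).
    move=> t [tS tx ty]; have tT : `[< Sigma t >] by apply/asboolP.
    (* A separation with [x] and [y] on opposite strict sides is decided oppositely by their
       centres, so its lower copy lies in the difference. *)
    exists ((exist _ t tT : P), false) => //.
    have cx : center x (exist _ t tT : P) by left.
    have cy : center y (pneg (exist _ t tT : P)) by left.
    split; first exact: cx.
    by move: cy => /[swap] /center_neg.
  by move=> t t' d _ _ [<- _] [<- _].
have [p /andP[wp /eqP <-]] := geodesic_exists G_conn x y.
apply: (@leq_trans (K * size p)); last by rewrite mulSn; lia.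
elim: p x wp => [|z p IHp] x; rewrite /walk /=.
  by move=> /eqP ->; rewrite gdistxx.
move=> /andP[/andP[xz zp] lp].
apply: leq_trans (gdist_triangle M_conn (center_vertex z) _ _) _.
rewrite mulnS leq_add//; last by apply: IHp; rewrite /walk zp lp.
apply: (dual_gdist_le center_base_orientation center_base_finite).
exact: center_orientation_adj_bounded.
Qed.

(** * Equivariance of the centres *)

Section Action.
Variables (Gamma : groupType) (aG : graph_action Gamma G).
Hypothesis Sinv : sep_invariant aG Sigma.
Let gt : Gamma -> P -> P := sep_act Sinv.

Let gt1 s : gt 1%g s = s. Proof. exact: sep_act1. Qed.
Let gtM g h s : gt (g * h)%g s = gt g (gt h s). Proof. exact: sep_actM. Qed.
Let gtK g s : gt g^-1%g (gt g s) = s. Proof. by rewrite -gtM mulVg. Qed.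
Let gtKV g s : gt g (gt g^-1%g s) = s. Proof. by rewrite -gtM mulgV. Qed.

Lemma sep_act_cuts g x s : cuts (aG g x) (gt g s) <-> cuts x s.
Proof.
split=> -[h1 h2]; first by move/sep_act_fst: h1; move/sep_act_snd: h2.
by split; [apply/sep_act_fst | apply/sep_act_snd].
Qed.

Lemma height_act g x s : height (aG g x) (gt g s) = height x s.
Proof.
suff le h y t : height y t <= height (aG h y) (gt h t).
  apply/eqP; rewrite eqn_leq le andbT.
  by have := le g^-1%g (aG g x) (gt g s); rewrite -actM mulVg act1 gtK.
have [c [cs cx] <-] := height_ex y t.
rewrite -(size_map (gt h)); apply: height_ge; split.
  have gt_inj : injective (gt h) by apply: can_inj (gtK h).
  apply: homo_sorted cs => q r /asboolP[sr nsr]; apply/asboolP.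
  by split; [exact: sep_act_le | move/gt_inj].
move=> _ /mapP[q qc ->]; have [qy qt] := cx q qc.
by split; [apply/sep_act_cuts | apply: sep_act_le].
Qed.

Lemma center_act g x s : center (aG g x) (gt g s) <-> center x s.
Proof.
suff imp h y t : center y t -> center (aG h y) (gt h t).
  split; last exact: imp.
  by move=> /(imp g^-1%g); rewrite -actM mulVg act1 gtK.
move=> [[t1 t2]|[ty ht]]; [left | right].
  by split; [apply/sep_act_fst | move=> /sep_act_snd].
split; first exact/sep_act_cuts.
by rewrite /gt -sep_act_neg !height_act.
Qed.

Definition double_act g (d : double P) : double P := (gt g d.1, d.2).

Lemma double_act1 d : double_act 1%g d = d.
Proof. by case: d => s b; rewrite /double_act gt1. Qed.

Lemma double_actM g h d : double_act (g * h)%g d = double_act g (double_act h d).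
Proof. by rewrite /double_act gtM. Qed.

Lemma double_act_le g (d e : double P) :
  ple d e -> ple (double_act g d) (double_act g e).
Proof.
case=> [[de h]|[de h]]; [left | right]; rewrite /= ?de//.
split; last exact: sep_act_le.
by move=> /(can_inj (gtK g)).
Qed.

Lemma double_act_neg g (d : double P) :
  double_act g (pneg d) = pneg (double_act g d).
Proof. by rewrite /double_act /= /double_neg /= /gt sep_act_neg. Qed.

Lemma center_orientation_act g x :
  double_act g @` center_orientation x = center_orientation (aG g x).
Proof.
have iff s b : center_orientation (aG g x) (gt g s, b) <->
    center_orientation x (s, b).
  case: b; last exact: center_act.
  have -> : center_orientation (aG g x) (gt g s, true) =
    (~ center (aG g x) (pneg (gt g s))) by [].
  by rewrite /gt -sep_act_neg center_act.
rewrite predeqE => -[s b]; split=> [[[t c] tc [<- <-]]|sb]; first exact/iff.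
exists (gt g^-1%g s, b); last by rewrite /double_act /= gtKV.
by apply/iff; rewrite gtKV.
Qed.

Lemma center_base_act g w : base w -> base (double_act g @` w).
Proof. by move=> [x _ <-]; exists (aG g x); rewrite // center_orientation_act. Qed.

Definition center_action : graph_action Gamma center_graph :=
  dual_graph_action double_act1 double_actM double_act_le double_act_neg
    center_base_act.

Lemma center_equivariant : equivariant aG center_action center_vertex.
Proof. by move=> g x; apply: val_inj; apply: center_orientation_act. Qed.

End Action.

End CanonicalOrientation.

(** * The implications between the three statements *)

Section Equivalences.
Variables (Gamma : groupType) (G : graph) (aG : graph_action Gamma G).
Hypothesis G_conn : connected_graph G.

Definition wide_separation_system (Sigma : set (set G * set G)) : Prop :=
  separation_system Sigma /\
  [/\ sep_invariant aG Sigma, sep_discrete Sigma, sep_crossing_bounded Sigma,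
      ECC Sigma & uniform_local_width Sigma /\ increasing_separations Sigma].

Lemma trace_seps_wide (M : graph) (aM : graph_action Gamma M)
    (F : G -> set M) (D : nat) :
    median_graph M -> graph_crossing_bounded M ->
    (forall x, F x !=set0) ->
    (forall x y, adj x y -> F x `&` F y !=set0) ->
    (forall x, diam_le (F x) D) ->
    (forall g x, F (aG g x) = aM g @` F x) ->
    (forall r, exists R, forall x y u v, F x u -> F y v -> gdist u v <= r ->
      gdist x y <= R) ->
  wide_separation_system (trace_seps F).
Proof.
move=> M_med M_bounded F0 F_adj F_diam F_act F_proper; split.
  exact: trace_seps_system.
split; [exact: trace_seps_invariant F_act | exact: trace_seps_discrete |
  exact: trace_seps_crossing_bounded | exact: trace_seps_ECC | split].
  exact: trace_seps_width F_diam.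
exact: trace_seps_increasing F_diam F_proper.
Qed.

Lemma embedding_separations (M : graph) (aM : graph_action Gamma M)
    (f : G -> M) :
    median_graph M -> graph_crossing_bounded M -> coarse_embedding f ->
    equivariant aG aM f ->
  exists Sigma, wide_separation_system Sigma.
Proof.
move=> M_med M_bounded [K [rho [_ _ /nat_cvg_infty rho_oo f_coarse]]] f_act.
have M_conn : connected_graph M by case: M_med.
have dC := gdistC M_conn; have dT := gdist_triangle M_conn.
(* Adjacent vertices have images at distance at most [K * 1 + K], so this radius makes the ball
   around [f x] contain [f y]. *)
pose F x := [set u | gdist (f x) u <= K + K].
exists (trace_seps F); apply: (trace_seps_wide (aM := aM)
  (D := (K + K) + (K + K))) => //.
- by move=> x; exists (f x); rewrite /F /= gdistxx.
- move=> x y xy; exists (f y); rewrite /F /= gdistxx; split=> //.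
  have /andP[_] := f_coarse x y.
  by rewrite (gdist_adj G_conn xy) muln1.
- move=> x u v xu xv; apply: leq_trans (dT (f x) u v) _.
  by rewrite (dC u) leq_add.
- move=> g x; rewrite predeqE => u; rewrite act_imageE /F /= -f_act.
  by rewrite -(gdist_act aM M_conn g (f x)) -actM mulgV act1.
(* If points of the two balls are within [r], the centres are within [r] plus two radii; [m] is a
   distance in [G] from which on [rho] exceeds this. *)
- move=> r; have [m mP] := rho_oo ((K + K) + (r + (K + K))).+1.
  exists m => x y u v; rewrite /F /= => xu yv uv.
  rewrite leqNgt; apply/negP => /ltnW /mP; rewrite ltnNge => /negP; apply.
  have /andP[+ _] := f_coarse x y => /leq_trans; apply.
  apply: leq_trans (dT u _ _) _; rewrite leq_add//.
  by apply: leq_trans (dT v _ _) _; rewrite leq_add// dC.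
Qed.

Lemma decomposition_separations (M : graph) (aM : graph_action Gamma M)
    (beta : M -> set G) :
    median_decomposition beta -> graph_crossing_bounded M ->
    canonical_decomposition beta aG aM -> proper_decomposition beta ->
  exists Sigma, wide_separation_system Sigma.
Proof.
move=> [M_med betaT beta_adj _] M_bounded beta_act [[D beta_diam] beta_proper].
exists (trace_seps (fibre beta)).
apply: (trace_seps_wide (aM := aM) (D := D)) => //.
- move=> x; have : (\bigcup_u beta u) x by rewrite betaT.
  by move=> [u _ xu]; exists u.
- move=> g x; rewrite predeqE => u; rewrite act_imageE /fibre /=.
  by rewrite -beta_act act_imageE invgK.
(* Proper support is applied at [u] itself, which lies in the fibre of [x] and within [r] of the
   fibre of [y]. *)
- move=> r; have [R RP] := beta_proper r; exists R => x y u v xu yv uv.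
  by apply: (RP u); [exists u; rewrite ?gdistxx | exists v].
Qed.

Lemma separations_embedding Sigma : wide_separation_system Sigma ->
  exists (M : graph) (aM : graph_action Gamma M) (f : G -> M),
    [/\ median_graph M, graph_crossing_bounded M,
        coarse_embedding f & equivariant aG aM f].
Proof.
move=> [Ssys [Sinv _ Scross _ [[R SR] Sinc]]].
exists (center_graph Ssys R), (center_action Ssys SR Sinv),
  (center_vertex Ssys SR).
split; [exact: center_graph_median | | exact: center_coarse |
  exact: center_equivariant].
apply: dual_crossing_bounded.
- exact: center_base_orientation.
- exact: center_base_finite.
- exact/double_crossing_bounded/sep_pocset_crossing_bounded.
Qed.

Lemma separations_decomposition Sigma : wide_separation_system Sigma ->
  exists (M : graph) (aM : graph_action Gamma M) (beta : M -> set G),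
    [/\ median_decomposition beta, graph_crossing_bounded M,
        canonical_decomposition beta aG aM, reduced_decomposition beta &
        proper_decomposition beta].
Proof.
move=> [Ssys [Sinv _ Scross _ [[R SR] Sinc]]].
exists (fibre_graph Ssys), (fibre_action Ssys Sinv), (@bag _ _ Ssys).
split; [exact: bag_decomposition SR G_conn | | exact: bag_canonical |
  exact: bag_reduced SR G_conn | split].
- apply: dual_crossing_bounded.
  + exact: fibres_orientation.
  + exact: fibres_finite SR G_conn.
  + exact: sep_pocset_crossing_bounded.
- exact: bag_bounded SR G_conn.
- exact: bag_properly_supported SR G_conn Sinc.
Qed.

End Equivalences.

Theorem theorem1p4 (Gamma : groupType) (G : graph)
    (aG : graph_action Gamma G) (G_conn : connected_graph G) :
  [<->
    (exists (M : graph) (aM : graph_action Gamma M) (f : G -> M),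
       [/\ median_graph M, graph_crossing_bounded M,
           coarse_embedding f & equivariant aG aM f]);
    (exists (M : graph) (aM : graph_action Gamma M) (beta : M -> set G),
       [/\ median_decomposition beta, graph_crossing_bounded M,
           canonical_decomposition beta aG aM, reduced_decomposition beta &
           proper_decomposition beta]);
    (exists Sigma : set (set G * set G),
       separation_system Sigma /\
       [/\ sep_invariant aG Sigma, sep_discrete Sigma,
           sep_crossing_bounded Sigma, ECC Sigma &
           uniform_local_width Sigma /\ increasing_separations Sigma])
  ].
Proof.
tfae.
- move=> [M [aM [f [M_med M_bounded f_coarse f_act]]]].
  (* The passage from an embedding to a decomposition goes through a separation system. *)
  have [Sigma] := embedding_separations G_conn M_med M_bounded f_coarse f_act.
  exact: separations_decomposition.
- move=> [M [aM [beta [beta_dec M_bounded beta_act _ beta_proper]]]].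
  exact: decomposition_separations beta_dec M_bounded beta_act beta_proper.
- move=> [Sigma]; exact: separations_embedding.
Qed.
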